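(* Let $d\ge 2$, let $\gamma\in(0,\tfrac12]$, and let $\{v_n\}_{n\ge 1}$ be a $\gamma$-uniformly distributed sequence of points on $\mathbb{T}^d$. For $\frac1{100}\le a\le b<\frac12$ put $$\Omega_{a,b}=\{(x,y)\in\mathbb{T}^d\times\mathbb{T}^d: a\le \|x-y\|\le b\},$$ and for an integer $N\ge 1$ define $R(a,b,N)$ by $$\#\{(n,m)\in\{1,\dots,N\}^2: a\le\|v_n-v_m\|\le b\}=N^2|\Omega_{a,b}|+R(a,b,N).$$ Then for every $\epsilon>0$ there is a constant $C_\epsilon>0$ (independent of $a,b,N$) such that for all $N\ge1$ and all $\frac1{100}\le a\le b<\frac12$, $$|R(a,b,N)|\le C_\epsilon N^{2-\frac{4\gamma}{d+1}+\epsilon}.$$ In particular, for every $c>0$ and $\epsilon>0$ there exist constants $0<A_1\le A_2$ and $N_0$ such that for all $N\ge N_0$ and all $\frac1{100}\le a\le b<\frac12$ with $b-a\ge cN^{-\frac{4\gamma}{d+1}+\epsilon}$, the number of incidences between the points $v_1,\dots,v_N$ and the $N$ annuli $\{x\in\mathbb{T}^d: a\le\|x-v_m\|\le b\}$, $1\le m\le N$, satisfies $$A_1N^2(b-a)\le \#\{(n,m)\in\{1,\dots,N\}^2: a\le\|v_n-v_m\|\le b\}\le A_2N^2(b-a).$$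
   Context: $\mathbb{T}^d=\mathbb{R}^d/\mathbb{Z}^d$, identified with the unit cube $[0,1]^d$ (opposite faces glued). For $x\in\mathbb{R}^d$, $\|x\|=\min_{m\in\mathbb{Z}^d}|x-m|$ is the Euclidean distance to the integer lattice; it is well defined on $\mathbb{T}^d$. $|S|$ denotes the Lebesgue measure of a subset $S$ of $\mathbb{R}^d$ or $\mathbb{T}^d$ (or of $\mathbb{T}^d\times\mathbb{T}^d$). For $\gamma\in(0,\frac12]$, a sequence of points $\{v_n\}_{n\ge1}$ in $[0,1]^d$ (or $\mathbb{T}^d$) is $\gamma$-uniformly distributed if for every $\epsilon>0$ there is a constant $C_\epsilon$ such that for every $k\in\mathbb{Z}^d\setminus\{0\}$ and every integer $N\ge 1$, $$\left|\frac1N\sum_{n=1}^N e^{2\pi i k\cdot v_n}\right|\le C_\epsilon|k|^\epsilon N^{-\gamma}.$$ *)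

(* Defs.v *)
From HB Require Import structures.
From mathcomp Require Import all_boot all_order all_algebra.
From mathcomp Require Import all_classical all_reals all_analysis.
From mathcomp Require Export complex.

Set Implicit Arguments.
Unset Strict Implicit.
Unset Printing Implicit Defensive.

Import Order.TTheory GRing.Theory Num.Theory.
Import numFieldNormedType.Exports.

Local Open Scope classical_set_scope.
Local Open Scope ring_scope.

(* A point of T^d = R^d/Z^d is given by any of its representatives in R^d,
   and a subset of T^d (or of T^d x T^d) by its Z^d-periodic preimage. *)

Section euclidean.
Context {R : realType} {d : nat}.

(* The library norm on row vectors is the sup norm. *)
Definition enorm (x : 'rV[R]_d) : R := Num.sqrt (\sum_(i < d) x 0 i ^+ 2).

Definition lattice_pt (m : 'rV[int]_d) : 'rV[R]_d := map_mx intr m.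

Definition dot (x y : 'rV[R]_d) : R := \sum_(i < d) x 0 i * y 0 i.

(* The infimum is attained, Z^d being closed and discrete. *)
Definition tnorm (x : 'rV[R]_d) : R :=
  inf [set enorm (x - lattice_pt m) | m in [set: 'rV[int]_d]].

End euclidean.

Section lebesgue.
Context {R : realType}.
Local Notation mR := (measurableTypeR R).

Definition tuple_cons n (p : mR * n.-tuple mR) : n.+1.-tuple mR :=
  [the n.+1.-tuple mR of p.1 :: p.2].

Lemma measurable_tuple_cons n : measurable_fun setT (@tuple_cons n).
Proof. exact: measurable_cons. Qed.

HB.instance Definition _ n :=
  isMeasurableFun.Build _ _ _ _ (@tuple_cons n) (@measurable_tuple_cons n).

Section step.
Variables (n : nat) (mu : {sigma_finite_measure set (n.-tuple mR) -> \bar R}).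

Definition lebesgue_step : set (n.+1.-tuple mR) -> \bar R :=
  pushforward (lebesgue_measure \x mu)%E (@tuple_cons n).

Let lebesgue_step0 : lebesgue_step set0 = 0%E.
Proof. exact: measure0. Qed.

Let lebesgue_step_ge0 A : (0 <= lebesgue_step A)%E.
Proof. exact: measure_ge0. Qed.

Let lebesgue_step_sigma_additive : semi_sigma_additive lebesgue_step.
Proof.
exact: (@measure_semi_sigma_additive _ _ _
  (pushforward (lebesgue_measure \x mu)%E (@tuple_cons n))).
Qed.

HB.instance Definition _ := isMeasure.Build _ _ _ lebesgue_step
  lebesgue_step0 lebesgue_step_ge0 lebesgue_step_sigma_additive.

Let lebesgue_step_sigma_finite : sigma_finite setT lebesgue_step.
Proof.
have /sigma_finiteP[F [TF ndF Foo]] := sigma_finiteT (@lebesgue_measure R).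
have /sigma_finiteP[G [TG ndG Goo]] := sigma_finiteT mu.
pose unc (t : n.+1.-tuple mR) : mR * n.-tuple mR :=
  (thead t, [tuple of behead t]).
have munc : measurable_fun setT unc.
  apply/measurable_fun_pairP; split; first exact: measurable_tnth.
  exact: measurable_behead.
have uncK p : unc (tuple_cons p) = p.
  by case: p => x t; congr pair => //; exact/val_inj.
exists (fun i => unc @^-1` (F i `*` G i)).
  rewrite -preimage_bigcup -(preimage_setT unc); congr (_ @^-1` _).
  apply/esym/seteqP; split => // -[x t] _.
  have [i _ Fx] : (\bigcup_i F i) x by rewrite -TF.
  have [j _ Gt] : (\bigcup_i G i) t by rewrite -TG.
  exists (maxn i j) => //; split => /=.
    by move: x Fx; exact/subsetPset/ndF/leq_maxl.
  by move: t Gt; exact/subsetPset/ndG/leq_maxr.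
move=> i; have [mF Fi] := Foo i; have [mG Gi] := Goo i; split.
  by rewrite -[_ @^-1` _]setTI; apply: munc => //; exact: measurableX.
rewrite /lebesgue_step /pushforward -comp_preimage.
rewrite (_ : unc \o _ = id); last exact/funext.
by rewrite preimage_id product_measure1E// lte_mul_pinfty// ge0_fin_numE.
Qed.

HB.instance Definition _ :=
  @Measure_isSigmaFinite.Build _ _ _ lebesgue_step lebesgue_step_sigma_finite.

End step.

(* n-dimensional Lebesgue measure as an iterated product measure. *)
Fixpoint lebesgue_tuple n : {sigma_finite_measure set (n.-tuple mR) -> \bar R} :=
  if n is m.+1 then lebesgue_step (lebesgue_tuple m) else \d_[tuple].

Lemma lebesgue_tuple_box n (A : 'I_n -> set mR) :
  (forall i, measurable (A i)) ->
  lebesgue_tuple n [set t | forall i, A i (tnth t i)] =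
  (\prod_(i < n) lebesgue_measure (A i))%E.
Proof.
elim: n A => [|n IHn] A mA /=.
  rewrite big_ord0 /dirac indicE mem_set//= => -[].
  by case.
rewrite big_ord_recl -IHn // /lebesgue_step /pushforward.
rewrite -product_measure1E //; last first.
  rewrite (_ : [set t : n.-tuple mR | forall i, A (lift ord0 i) (tnth t i)] =
    \bigcap_(i in [set: 'I_n]) ((fun t => tnth t i) @^-1` A (lift ord0 i))).
    apply: fin_bigcap_measurable => // i _.
    by rewrite -[_ @^-1` _]setTI; exact: measurable_tnth.
  by apply/seteqP; split => t /= H i; [move=> _; exact: H|exact: H].
congr product_measure1; apply/seteqP; split => -[x t] /=.
  move=> H; split; first exact: (H ord0).
  by move=> i; have := H (lift ord0 i); rewrite tnthS.
move=> [Hx Ht] i; by have [j ->|->] := unliftP ord0 i => //; rewrite tnthS.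
Qed.

End lebesgue.

Section torus.
Context {R : realType} {d : nat}.
Implicit Types (v : nat -> 'rV[R]_d) (a b : R) (N : nat).

Definition unit_cube : set 'rV[R]_d := [set x | forall i, 0 <= x 0 i <= 1].

Definition row_of_tuple (t : d.-tuple (measurableTypeR R)) : 'rV[R]_d :=
  \row_(i < d) tnth t i.

Definition torus2_volume (S : set ('rV[R]_d * 'rV[R]_d)) : R :=
  fine ((lebesgue_tuple d \x lebesgue_tuple d)%E
    [set p | let x := row_of_tuple p.1 in let y := row_of_tuple p.2 in
             [/\ unit_cube x, unit_cube y & S (x, y)]]).

Definition expi2pi (t : R) : R[i] := (cos (2 * pi * t) +i* sin (2 * pi * t))%C.

(* Sequences are indexed from 1: the value v 0 is never used. *)
Definition uniformly_distributed (gamma : R) v :=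
  forall eps : R, 0 < eps -> exists C : R,
    forall (k : 'rV[int]_d) N, k != 0 -> (1 <= N)%N ->
    `| N%:R^-1 * \sum_(1 <= n < N.+1) expi2pi (dot (lattice_pt k) (v n)) |
      <= (C * enorm (lattice_pt k) `^ eps * N%:R `^ (- gamma))%:C%C.

Definition Omega a b : set ('rV[R]_d * 'rV[R]_d) :=
  [set p | a <= tnorm (p.1 - p.2) <= b].

(* Here and below, i : 'I_N stands for the index i + 1 of {1, ..., N}. *)
Definition pair_count v a b N : nat :=
  #|[pred p : 'I_N * 'I_N | a <= tnorm (v p.1.+1 - v p.2.+1) <= b]|.

Definition remainder v a b N : R :=
  (pair_count v a b N)%:R - N%:R ^+ 2 * torus2_volume (Omega a b).

Definition annulus a b (y : 'rV[R]_d) : set 'rV[R]_d :=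
  [set x | a <= tnorm (x - y) <= b].

Definition incidences v a b N : nat :=
  #|[pred p : 'I_N * 'I_N | v p.1.+1 \in annulus a b (v p.2.+1)]|.

Lemma incidencesE v a b N : incidences v a b N = pair_count v a b N.
Proof. by apply: eq_card => p; rewrite !inE; apply: asboolb. Qed.

End torus.

(* Main.v *)
Require Import Defs.
From mathcomp Require Import all_boot all_order all_algebra.
From mathcomp Require Import all_classical all_reals all_analysis.
From mathcomp Require Import measurable_realfun ring lra zify.
Import Order.TTheory GRing.Theory Num.Theory.
Local Open Scope ring_scope.
Set Implicit Arguments.
Unset Strict Implicit.
Unset Printing Implicit Defensive.
Import ComplexField.Normc.

(** Write f for the indicator of the annulus a <= |x| <= b on the torus. The count
    is the sum of f (v_n - v_m), and expanding f in a Fourier series turns it into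
    a sum over frequencies k of the coefficient of f at k times |S_k|^2, where
    S_k = e(k.v_1) + ... + e(k.v_N). The frequency 0 gives N^2 times the volume,
    and uniform distribution bounds every other |S_k|^2 by about N^(2 - 2 gamma).
    Since the series of |f^(k)| diverges, f is first smoothed at a scale delta.
    This costs N^2 delta, the proportion of pairs near the boundary spheres, and
    leaves the frequencies up to 1 / delta, whose coefficients add up to about
    delta^(- (d - 1) / 2). The choice delta = N^(- 4 gamma / (d + 1)) balances
    the two errors, and the powers N^eps absorb logarithms and kernel tails.

    The size of the Fourier coefficients comes from translations. The
    indicator of a shell changes only near two spheres when it is translated by h,
    hence in mean square by O(|h|) ([density_boundary]). By Bessel's inequality,
    applied to translations along the axes by all dyadic lengths, the sum of
    |k| |f^(k)|^2 over the relevant frequencies is at most logarithmic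
    ([sum_coef_weight]), and Cauchy-Schwarz gives the sum of the |f^(k)|
    ([sum_coef_le]).

    All expansions are finite sums ([sum_smooth_expand]): the smoothing kernel is a
    nonnegative trigonometric polynomial, the squared modulus of a power of a
    Dirichlet kernel ([jackson]), and integrals over the torus are replaced by
    averages over the grid (1/M) Z^d modulo Z^d, on which characters of frequency
    below M are still orthogonal ([char_orthogonal]). The kernel decays so fast that smoothing a
    slightly larger or smaller shell gives a majorant or minorant of f up to a
    negligible error ([smooth_majorant], [smooth_minorant]).

    Geometry enters through the count of grid points in a thin shell, which is
    O(w + 1/M) for width w ([density_shell]); along the axis of the largest
    coordinate the sphere is met transversally. Lebesgue measure is compared with
    grid counts by covering the region and its complement with small cubes
    ([torus2_volume_density]). The same comparison shows that the volume of
    the annulus region lies between constant multiples of b - a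
    ([torus2_volume_ge], [torus2_volume_le]), and the second claim follows from the
    first once the remainder is less than half of the main term. *)

(** * Complex exponentials and distance to the nearest integer *)

Section exponential.
Context {R : realType}.
Implicit Types (t : R) (z : R[i]).

Lemma normc_ge0 z : 0 <= normc z.
Proof. by case: z => a b; exact: sqrtr_ge0. Qed.

Lemma normc_sqr z : (normc z ^+ 2)%:C%C = z * conjc z.
Proof.
case: z => a b /=; rewrite sqr_sqrtr ?addr_ge0 ?sqr_ge0//.
by apply/eqP; rewrite eq_complex /=; apply/andP; split; apply/eqP; ring.
Qed.

Lemma normc_conj z : normc (conjc z) = normc z.
Proof. by case: z => a b /=; rewrite sqrrN. Qed.

Lemma normc_real (x : R) : normc x%:C%C = `|x|.
Proof. by rewrite /= expr0n /= addr0 sqrtr_sqr. Qed.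

Lemma normcX z n : normc (z ^+ n) = normc z ^+ n.
Proof.
by elim: n => [|n IH]; rewrite ?expr0 ?normc1// !exprS normcM IH.
Qed.

Lemma conjcM : {morph @conjc R : x y / x * y}.
Proof. exact: (rmorphM conjc). Qed.

Lemma conjcX n : {morph @conjc R : x / x ^+ n}.
Proof. exact: (rmorphXn conjc). Qed.

Lemma normc_sum (I : Type) (s : seq I) (P : pred I) (F : I -> R[i]) :
  normc (\sum_(i <- s | P i) F i) <= \sum_(i <- s | P i) normc (F i).
Proof.
elim/big_rec2: _ => [|i x y _ le_yx]; first by rewrite normc0.
by rewrite (le_trans (le_normcD _ _))// lerD2l.
Qed.

Lemma expi2piD s t : expi2pi (s + t) = expi2pi s * expi2pi t.
Proof.
rewrite /expi2pi mulrDr cosD sinD; apply/eqP; rewrite eq_complex /=.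
by apply/andP; split; apply/eqP; ring.
Qed.

Lemma expi2pi0 : expi2pi (0 : R) = 1.
Proof. by rewrite /expi2pi mulr0 cos0 sin0. Qed.

Lemma expi2piN t : expi2pi (- t) = conjc (expi2pi t).
Proof. by rewrite /expi2pi mulrN cosN sinN. Qed.

Lemma normc_expi2pi t : normc (expi2pi t) = 1.
Proof. by rewrite /= cos2Dsin2 sqrtr1. Qed.

Lemma expi2pi_sum (I : Type) (s : seq I) (P : pred I) (F : I -> R) :
  expi2pi (\sum_(i <- s | P i) F i) = \prod_(i <- s | P i) expi2pi (F i).
Proof.
elim/big_rec2: _ => [|i x y _ <-]; first exact: expi2pi0.
by rewrite expi2piD.
Qed.

Lemma expi2pi_mulrn t n : expi2pi (t *+ n) = expi2pi t ^+ n.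
Proof.
elim: n => [|n IH]; first by rewrite mulr0n expr0 expi2pi0.
by rewrite mulrS exprS expi2piD IH.
Qed.

Lemma expi2pi1 : expi2pi (1 : R) = 1.
Proof. by rewrite /expi2pi mulr1 mulr_natl cos2pi sin2pi. Qed.

Lemma expi2pi_int (m : int) : expi2pi (m%:~R : R) = 1.
Proof.
have nat1 n : expi2pi (n%:R : R) = 1 by rewrite expi2pi_mulrn expi2pi1 expr1n.
by case: m => n; rewrite ?NegzE ?rmorphN /= ?expi2piN -pmulrn nat1// conjc1.
Qed.

Lemma normc_subC (x y : R[i]) : normc (x - y) = normc (y - x).
Proof. by rewrite -opprB normcN. Qed.

Lemma normc1B_expi2pi_sqr t :
  normc (1 - expi2pi t) ^+ 2 = 2 - 2 * cos (2 * pi * t).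
Proof.
apply: complexI; rewrite normc_sqr /expi2pi; apply/eqP; rewrite eq_complex /=.
have := cos2Dsin2 (2 * pi * t); set c := cos _; set s := sin _ => cs.
apply/andP; split; apply/eqP; last by ring.
rewrite add0r mulrNN; rewrite -!expr2 in cs *.
by rewrite mulrN opprK -expr2 -(addrK (c ^+ 2) (s ^+ 2)) [s ^+ 2 + _]addrC cs; ring.
Qed.

(** The angle 2 pi t then lies in the closed left half of the circle, where the
    cosine is nonpositive. *)
Lemma normc1B_expi2pi_far t : 1 / 4 <= `|t| <= 1 / 2 ->
  2 <= normc (1 - expi2pi t) ^+ 2.
Proof.
move=> /andP[t1 t2]; rewrite normc1B_expi2pi_sqr.
suff : cos (2 * pi * t) <= 0 by lra.
have := pi_gt0 R; set p := pi => p0.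
rewrite -cos_norm normrM (ger0_norm (_ : 0 <= 2 * p)) ?mulr_ge0 ?(ltW p0)//.
set u := `|t| in t1 t2 *.
rewrite -[2 * p * u](subrK p) cosDpi -/p oppr_le0 cos_ge0_pihalf//.
by apply/andP; split; nra.
Qed.

Lemma normc_geometric t L :
  normc (\sum_(i < L) expi2pi t ^+ i) * normc (1 - expi2pi t) <= 2.
Proof.
rewrite mulrC -normcM -opprB mulNr -subrX1 normcN.
apply: le_trans (le_normcD _ _) _.
by rewrite normcN normcX normc_expi2pi expr1n normc1 lerD.
Qed.

Lemma normc1B_expi2piMn t n :
  normc (1 - expi2pi (t *+ n)) <= n%:R * normc (1 - expi2pi t).
Proof.
rewrite expi2pi_mulrn -[1 - _ ^+ n]opprB subrX1 -mulNr opprB normcM mulrC.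
apply: ler_wpM2r; first exact: normc_ge0.
apply: le_trans (normc_sum _ _ _) _.
rewrite (eq_bigr (fun=> 1)) => [|i _]; last by rewrite normcX normc_expi2pi expr1n.
by rewrite sumr_const card_ord.
Qed.

End exponential.

Section dist_to_int.
Context {R : realType}.
Implicit Types (t u : R).

Definition distZ t : R :=
  Num.min (t - (Num.floor t)%:~R) (1 - (t - (Num.floor t)%:~R)).

Lemma distZ_attained t : exists m : int, distZ t = `|t - m%:~R|.
Proof.
have /andP[f1 f2] := floor_itv t; rewrite intrD mulr1z in f2.
rewrite /distZ; case: leP => _.
  by exists (Num.floor t); rewrite ger0_norm// subr_ge0.
exists (Num.floor t + 1); rewrite intrD mulr1z ler0_norm; last by lra.
by rewrite opprB; ring.
Qed.

Lemma distZ_le t (m : int) : distZ t <= `|t - m%:~R|.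
Proof.
have /andP[f1 f2] := floor_itv t; rewrite intrD mulr1z in f2.
rewrite /distZ ge_min; have [mf|mf] := leP m (Num.floor t).
  apply/orP; left; apply: le_trans (ler_norm _).
  by rewrite lerD2l lerN2 ler_int.
apply/orP; right; rewrite distrC; apply: le_trans (ler_norm _).
have : (Num.floor t + 1)%:~R <= m%:~R :> R by rewrite ler_int lezD1.
by rewrite intrD mulr1z; lra.
Qed.

Lemma distZ_ge0 t : 0 <= distZ t.
Proof. by have [m ->] := distZ_attained t. Qed.

Lemma distZ_le_half t : distZ t <= 1 / 2.
Proof. by rewrite /distZ; move: (t - _) => u; case: (leP u) => ?; lra. Qed.

Lemma distZ_le_norm t : distZ t <= `|t|.
Proof. by have := distZ_le t 0; rewrite subr0. Qed.

Lemma distZDz t (m : int) : distZ (t + m%:~R) = distZ t.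
Proof.
apply/le_anti/andP; split.
  have [n ->] := distZ_attained t.
  have := distZ_le (t + m%:~R) (n + m); rewrite intrD.
  by congr (_ <= `|_|); ring.
have [n ->] := distZ_attained (t + m%:~R).
have := distZ_le t (n - m); rewrite intrB.
by congr (_ <= `|_|); ring.
Qed.

Lemma distZN t : distZ (- t) = distZ t.
Proof.
apply/le_anti/andP; split.
  have [n ->] := distZ_attained t.
  by have := distZ_le (- t) (- n); rewrite intrN -opprD normrN.
have [n ->] := distZ_attained (- t).
by have := distZ_le t (- n); rewrite intrN -normrN opprB addrC.
Qed.

Lemma distZD t u : distZ (t + u) <= distZ t + distZ u.
Proof.
have [m ->] := distZ_attained t; have [n ->] := distZ_attained u.
apply: le_trans (distZ_le _ (m + n)) _; rewrite intrD.
by apply: le_trans (ler_normD _ _); rewrite addrACA -opprD.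
Qed.

Lemma distZ_unit t : `|t| <= 1 -> distZ t = Num.min `|t| (1 - `|t|).
Proof.
move=> t1; have -> : distZ t = distZ `|t|.
  by case: (ler0P t) => // _; rewrite distZN.
move: (`|t|) (normr_ge0 t) t1 => {}t t0 t1.
move: t1; rewrite le_eqVlt => /orP[/eqP->|t1].
  by rewrite /distZ floor1 mulr1z !subrr subr0 minC.
have -> : distZ t = Num.min (t - 0) (1 - (t - 0)).
  by rewrite /distZ (_ : Num.floor t = 0)//; apply/floor_def; rewrite add0r t0.
by rewrite subr0.
Qed.

(** Up to sign and an integer, t lies in [0, 1/2]. If t > 0, some multiple n t lies
    in [1/4, 1/2], so e(n t) is at distance at least sqrt 2 from 1; since
    |1 - e(n t)| <= n |1 - e(t)| and n <= 1 / (2 t), the bound follows. *)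
Lemma normc1B_expi2pi_ge t : 2 * distZ t <= normc (1 - expi2pi t).
Proof.
have [m tm] := distZ_attained t.
have -> : normc (1 - expi2pi t) = normc (1 - expi2pi (distZ t)).
  rewrite -[in LHS](subrK m%:~R t) expi2piD expi2pi_int mulr1 tm.
  case: ger0P => // _; rewrite expi2piN.
  by rewrite -normc_conj rmorphB rmorph1.
move: (distZ t) (distZ_ge0 t) (distZ_le_half t) => {tm m}{}t t0 t1.
move: t0; rewrite le_eqVlt => /orP[/eqP <-|t0]; first by rewrite mulr0 normc_ge0.
(* The largest n with n t <= 1/2; it satisfies n t >= 1/4 because n >= 1. *)
pose n := Num.truncn (1 / (2 * t)).
have /andP[n1 n2] : n%:R <= 1 / (2 * t) < n.+1%:R.
  by apply: truncn_itv; rewrite divr_ge0// mulr_ge0// ltW.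
have nt : n%:R * t <= 1 / 2 by move: n1; rewrite ler_pdivlMr ?mulr_gt0//; lra.
have nt' : 1 / 2 < n.+1%:R * t by move: n2; rewrite ltr_pdivrMr ?mulr_gt0//; lra.
have n0 : (0 < n)%N by rewrite truncn_gt0 ler_pdivlMr ?mulr_gt0//; lra.
have n1' : (1 : R) <= n%:R by rewrite ler1n.
have H : 1 / 4 <= `|t *+ n| <= 1 / 2.
  rewrite -(mulr_natl t) ger0_norm ?mulr_ge0 ?(ltW t0)// nt andbT.
  by move: nt'; rewrite -[n.+1%:R]natr1; nra.
have := normc1B_expi2pi_far H; have := normc1B_expi2piMn t n.
set x := normc (1 - expi2pi t); set y := normc _ => yx y2.
have y0 : 0 <= y := normc_ge0 _.
have y1 : 1 <= y by nra.
nra.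
Qed.

(** The decay of the Dirichlet kernel away from the integers: the geometric sum
    times 1 - e(t) is at most 2, and 1 - e(t) is at least 2 dist(t, Z). *)
Lemma normc_geometric_le t L : distZ t * normc (\sum_(i < L) expi2pi t ^+ i) <= 1.
Proof.
have := normc_geometric t L; have := normc1B_expi2pi_ge t.
have := normc_ge0 (\sum_(i < L) expi2pi t ^+ i); set x := normc _; set y := normc _.
nra.
Qed.

Lemma distZ_frac k M : (k <= M)%N -> (0 < M)%N ->
  distZ (k%:R / M%:R) = Num.min k%:R (M%:R - k%:R) / M%:R.
Proof.
move=> kM M0; have M0' : (0 : R) < M%:R by rewrite ltr0n.
have k0 : 0 <= k%:R / M%:R :> R by rewrite divr_ge0.
rewrite distZ_unit; last by rewrite ger0_norm// ler_pdivrMr// mul1r ler_nat.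
rewrite ger0_norm// minr_pMl ?invr_ge0 ?ltW//.
by rewrite mulrBl divff// gt_eqF.
Qed.

Lemma sum_expi2pi_frac k M : (0 < k < M)%N ->
  \sum_(x < M) expi2pi (k%:R / M%:R : R) ^+ x = 0.
Proof.
move=> /andP[k0 kM]; have M0 : (0 < M)%N by apply: leq_ltn_trans kM.
have M0' : (0 : R) < M%:R by rewrite ltr0n.
apply/eqP; set w := expi2pi _.
have w1 : w - 1 != 0.
  apply: contraTneq (normc1B_expi2pi_ge (k%:R / M%:R)) => w0.
  rewrite -/w normc_subC w0 normc0 -ltNge distZ_frac ?(ltnW kM)//.
  by rewrite mulr_gt0// divr_gt0// lt_min ltr0n k0 subr_gt0 ltr_nat.
have := subrX1 w M; rewrite -expi2pi_mulrn -[_ *+ M]mulr_natr divfK ?(gt_eqF M0')//.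
rewrite (_ : expi2pi k%:R = 1) ?subrr; last exact: (expi2pi_int k).
by move/esym/eqP; rewrite mulf_eq0 (negbTE w1).
Qed.

End dist_to_int.

(** * The torus norm *)

Section real_sums.
Context {R : realType}.

Lemma cauchy_schwarz (I : finType) (a b : I -> R) :
  (\sum_i a i * b i) ^+ 2 <= (\sum_i a i ^+ 2) * (\sum_i b i ^+ 2).
Proof.
have : 0 <= \sum_i \sum_j (a i * b j - b i * a j) ^+ 2.
  by apply: sumr_ge0 => i _; apply: sumr_ge0 => j _; exact: sqr_ge0.
have -> : \sum_i \sum_j (a i * b j - b i * a j) ^+ 2 =
    (\sum_i a i ^+ 2) * (\sum_i b i ^+ 2) + (\sum_i b i ^+ 2) * (\sum_i a i ^+ 2)
    - 2 * ((\sum_i a i * b i) * (\sum_i a i * b i)).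
  rewrite !big_distrlr /= mulr_sumr -big_split /= -sumrB; apply: eq_bigr => i _.
  by rewrite mulr_sumr -big_split /= -sumrB; apply: eq_bigr => j _; ring.
by rewrite -expr2; set X := _ ^+ 2; lra.
Qed.

Lemma minkowski2 (I : finType) (a b : I -> R) :
  Num.sqrt (\sum_i (a i + b i) ^+ 2) <=
  Num.sqrt (\sum_i a i ^+ 2) + Num.sqrt (\sum_i b i ^+ 2).
Proof.
set A := \sum_i a i ^+ 2; set B := \sum_i b i ^+ 2.
have A0 : 0 <= A by apply: sumr_ge0 => i _; exact: sqr_ge0.
have B0 : 0 <= B by apply: sumr_ge0 => i _; exact: sqr_ge0.
rewrite -(ler_pXn2r (n := 2)) ?nnegrE ?addr_ge0 ?sqrtr_ge0//.
rewrite sqr_sqrtr; last by apply: sumr_ge0 => i _; exact: sqr_ge0.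
rewrite sqrrD !sqr_sqrtr//.
have -> : \sum_i (a i + b i) ^+ 2 = A + (\sum_i a i * b i) *+ 2 + B.
  by rewrite -sumrMnl -!big_split /=; apply: eq_bigr => i _; rewrite sqrrD.
rewrite lerD2r lerD2l lerMn2r /= -sqrtrM//; apply: le_trans (ler_norm _) _.
by rewrite -sqrtr_sqr ler_wsqrtr// cauchy_schwarz.
Qed.

Lemma sqrt_sum_sqr_le (I : finType) (a : I -> R) : (forall i, 0 <= a i) ->
  Num.sqrt (\sum_i a i ^+ 2) <= \sum_i a i.
Proof.
move=> a0; have s0 : 0 <= \sum_i a i by apply: sumr_ge0.
rewrite -[leRHS]ger0_norm// -sqrtr_sqr ler_wsqrtr// expr2 mulr_suml.
apply: ler_sum => i _; rewrite expr2 ler_wpM2l//.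
by rewrite (bigD1 i)//= lerDl sumr_ge0.
Qed.

End real_sums.

Section torus_norm.
Context {R : realType} {d : nat}.
Implicit Types x y : 'rV[R]_d.

(** The nearest lattice point can be chosen coordinate by coordinate. *)
Lemma tnormE x : tnorm x = Num.sqrt (\sum_i distZ (x 0 i) ^+ 2).
Proof.
have /boolp.choice[m xm] : forall i, exists m : int, distZ (x 0 i) = `|x 0 i - m%:~R|.
  by move=> i; exact: distZ_attained.
have lb : lbound [set enorm (x - lattice_pt m) | m in [set: 'rV[int]_d]]%classic
    (Num.sqrt (\sum_i distZ (x 0 i) ^+ 2)).
  move=> _ [n _ <-]; apply: ler_wsqrtr; apply: ler_sum => i _.
  rewrite -[leRHS]real_normK ?num_real// lerXn2r ?nnegrE ?distZ_ge0//.
  by rewrite !mxE distZ_le.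
have ex : [set enorm (x - lattice_pt m) | m in [set: 'rV[int]_d]]%classic
    (Num.sqrt (\sum_i distZ (x 0 i) ^+ 2)).
  exists (\row_i m i) => //; congr Num.sqrt; apply: eq_bigr => i _.
  by rewrite xm real_normK ?num_real// !mxE.
apply/le_anti/andP; split; first by apply: ge_inf => //; eexists; exact: lb.
by apply: lb_le_inf => //; eexists; exact: ex.
Qed.

Lemma eq_tnorm x y : (forall i, distZ (x 0 i) = distZ (y 0 i)) ->
  tnorm x = tnorm y.
Proof. by move=> xy; rewrite !tnormE; congr Num.sqrt; under eq_bigr do rewrite xy. Qed.

Lemma tnorm_ge0 x : 0 <= tnorm x.
Proof. by rewrite tnormE sqrtr_ge0. Qed.

Lemma tnormN x : tnorm (- x) = tnorm x.
Proof. by apply: eq_tnorm => i; rewrite mxE distZN. Qed.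

Lemma tnorm_le_sum x : tnorm x <= \sum_i distZ (x 0 i).
Proof. by rewrite tnormE; apply: sqrt_sum_sqr_le => i; exact: distZ_ge0. Qed.

Lemma tnormD x y : tnorm (x + y) <= tnorm x + tnorm y.
Proof.
rewrite !tnormE; apply: le_trans (minkowski2 _ _); apply: ler_wsqrtr.
apply: ler_sum => i _; rewrite mxE lerXn2r ?nnegrE ?addr_ge0 ?distZ_ge0//.
exact: distZD.
Qed.

Lemma tnorm_lipschitz x y : `|tnorm x - tnorm y| <= \sum_i distZ (x 0 i - y 0 i).
Proof.
have xy : tnorm (x - y) <= \sum_i distZ (x 0 i - y 0 i).
  apply: le_trans (tnorm_le_sum _) _.
  by apply: ler_sum => i _; rewrite !mxE.
rewrite ler_norml; apply/andP; split.
  rewrite lerNl opprB; have := tnormD (y - x) x; rewrite subrK -(tnormN (y - x)) opprB.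
  by lra.
by have := tnormD (x - y) y; rewrite subrK; lra.
Qed.

End torus_norm.

(** * The finite grid *)

Section grid.
Context {R : realType} {d m : nat}.
Local Notation M := m.+1.
Local Notation grid := {ffun 'I_d -> 'I_m.+1}.
Implicit Types (y h : grid) (j : 'I_d) (t : 'I_m.+1).

Definition grid_pt y : 'rV[R]_d := \row_i ((y i)%:R / M%:R).

(** The grid is the group (Z/M)^d; addition of indices agrees with addition of
    points only modulo the integer lattice. *)
Lemma grid_ptD y h i : exists n : int,
  grid_pt (y + h) 0 i = grid_pt y 0 i + grid_pt h 0 i + n%:~R.
Proof.
exists (- ((y i + h i) %/ M)%N%:Z); rewrite !mxE !ffunE /=.
have M0 : M%:R != 0 :> R by rewrite pnatr_eq0.
apply: (mulIf M0); rewrite !mulrDl !divfK// mulrNz mulNr.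
have := divn_eq (y i + h i) M => /(congr1 (fun n => n%:R : R)).
rewrite natrD [in X in _ = X]natrD natrM -pmulrn => ->.
by rewrite addrC addKr.
Qed.

Definition axis j t : grid := [ffun i => if i == j then t else 0].

Lemma distZ_gridD y h i :
  distZ (grid_pt (y + h) 0 i) = distZ (grid_pt y 0 i + grid_pt h 0 i).
Proof. by have [n ->] := grid_ptD y h i; rewrite distZDz. Qed.

(** Averaging over translates along a coordinate axis: a form of Fubini's theorem
    that keeps the index set {ffun 'I_d -> 'I_M} whole. *)
Lemma sum_lines (F : grid -> R) j :
  M%:R * \sum_y F y = \sum_(y : grid) \sum_t F (y + axis j t).
Proof.
rewrite [RHS]exchange_big /= [RHS](eq_bigr (fun=> \sum_(y : grid) F y)) => [|t _].
  by rewrite sumr_const card_ord mulr_natl.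
by rewrite [RHS](reindex_inj (@addIr grid (axis j t))).
Qed.

Lemma sum_coordinate (F : 'I_M -> R) j :
  M%:R * \sum_(y : grid) F (y j) = M%:R ^+ d * \sum_t F t.
Proof.
rewrite (sum_lines (fun y => F (y j)) j).
rewrite [LHS](eq_bigr (fun=> \sum_t F t)) => [|y _].
  by rewrite sumr_const card_ffun !card_ord -natrX mulr_natl.
rewrite [RHS](reindex_inj (@addrI 'I_M (y j))); apply: eq_bigr => t _.
by rewrite !ffunE eqxx.
Qed.

Lemma natr_card (T : finType) (P : pred T) :
  #|P|%:R = \sum_x (P x)%:R :> R.
Proof.
rewrite -sum1_card natr_sum big_mkcond /=; apply: eq_bigr => x _.
by rewrite unfold_in; case: (P x).
Qed.

Lemma card_close_ord (A : pred 'I_M) (W : R) :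
  0 <= W -> {in A &, forall t u : 'I_M, `|t%:R - u%:R| <= W} -> #|A|%:R <= W + 1.
Proof.
move=> W0 AW; case: (pickP A) => [t0 At0|A0]; last first.
  by rewrite (eq_card0 A0) addr_ge0.
have [k Ak kmin] := @arg_minnP _ t0 A (fun t => nat_of_ord t) At0.
have W1 := truncn_itv W0; pose n := Num.truncn W.
have le_n (t : 'I_M) : A t -> (t <= k + n)%N.
  move=> At; have kt : (k <= t)%N by apply: kmin.
  rewrite -leq_subLR truncn_ge_nat// natrB//; apply: le_trans (AW _ _ At Ak).
  exact: ler_norm.
have le_card : (#|A| <= n.+1)%N.
  rewrite -[n.+1]card_ord.
  pose f (t : 'I_M) : 'I_n.+1 := inord (t - k).
  rewrite -(@card_in_imset _ _ f); first exact: max_card.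
  move=> t u At Au /(congr1 val) /=.
  rewrite !inordK ?ltnS ?leq_subLR ?le_n// => /eqP.
  by rewrite eqn_sub2rE ?kmin// => /eqP tu; apply: val_inj.
apply: le_trans (_ : n.+1%:R <= _); first by rewrite ler_nat.
by rewrite -natr1 lerD2r; case/andP: W1.
Qed.

(** On each half of the circle Z/M the distance to the integers is a monotone
    linear function of the index, so a set of distances of diameter W meets each
    half in at most W M + 1 points. *)
Lemma card_close_dist (A : pred 'I_M) (W : R) : 0 <= W ->
  {in A &, forall t u : 'I_M, `|distZ (t%:R / M%:R : R) - distZ (u%:R / M%:R : R)| <= W} ->
  #|A|%:R <= 2 * (W * M%:R + 1).
Proof.
move=> W0 AW; pose h := [pred t : 'I_M | t%:R <= M%:R - t%:R :> R].
have M0 : 0 < M%:R :> R by rewrite ltr0n.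
have dE (t : 'I_M) : distZ (t%:R / M%:R : R) * M%:R = if t \in h then t%:R else M%:R - t%:R.
  rewrite distZ_frac// ?(ltnW (ltn_ord t))// divfK ?gt_eqF// inE /=.
  by case: leP.
have W0' : 0 <= W * M%:R by rewrite mulr_ge0.
have AWM (t u : 'I_M) : t \in A -> u \in A ->
    `|distZ (t%:R / M%:R : R) * M%:R - distZ (u%:R / M%:R : R) * M%:R| <= W * M%:R.
  move=> At Au; rewrite -mulrBl normrM (ger0_norm (ltW M0)).
  by apply: ler_wpM2r; [exact: ltW | exact: AW].
rewrite -(cardID h A) natrD mulr_natl mulr2n; apply: lerD.
  apply: card_close_ord => // t u /andP[At ht] /andP[Au hu].
  by have := AWM _ _ At Au; rewrite !dE ht hu.
apply: card_close_ord => // t u /andP[ht At] /andP[hu Au].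
have := AWM _ _ At Au; rewrite !dE !ifN//.
by rewrite distrC; congr (`|_| <= _); ring.
Qed.

End grid.

(** * Counting grid points in thin shells *)

Section shells.
Context {R : realType} {d m : nat}.
Local Notation M := m.+1.
Local Notation grid := {ffun 'I_d -> 'I_m.+1}.
Implicit Types (y h : grid) (j : 'I_d) (t : 'I_m.+1).

Lemma card_by_lines (A : pred grid) j (K : R) :
  (forall y, #|[pred t | A (y + axis j t)]|%:R <= K) ->
  #|A|%:R * M%:R <= K * M%:R ^+ d.
Proof.
move=> AK; rewrite natr_card mulrC (sum_lines (fun y => (A y)%:R) j).
apply: le_trans (_ : \sum_(y : grid) K <= _).
  by apply: ler_sum => y _; have := AK y; rewrite natr_card.
by rewrite sumr_const card_ffun !card_ord -natrX mulr_natr.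
Qed.

Definition dist_norm y : R := tnorm (grid_pt y : 'rV[R]_d).

Lemma dist_norm_sqr y : dist_norm y ^+ 2 = \sum_i distZ ((y i)%:R / M%:R : R) ^+ 2.
Proof.
rewrite /dist_norm tnormE sqr_sqrtr; last by apply: sumr_ge0 => i _; exact: sqr_ge0.
by apply: eq_bigr => i _; rewrite mxE.
Qed.

Lemma dist_norm_ge0 y : 0 <= dist_norm y.
Proof. exact: tnorm_ge0. Qed.

Definition shell (r s : R) : pred grid := [pred y | r <= dist_norm y <= s].

Definition density (A : pred grid) : R := #|A|%:R / M%:R ^+ d.

Lemma gridM_gt0 : 0 < M%:R ^+ d :> R.
Proof. by rewrite exprn_gt0. Qed.

Lemma density_ge0 (A : pred grid) : 0 <= density A.
Proof. by rewrite divr_ge0// ltW// gridM_gt0. Qed.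

Lemma density_sub (A B : pred grid) : (forall y, A y -> B y) ->
  density A <= density B.
Proof.
move=> AB; rewrite ler_pM2r ?invr_gt0 ?gridM_gt0// ler_nat subset_leq_card//.
by apply/fintype.subsetP => y; exact: AB.
Qed.

Lemma densityU (A B C : pred grid) : (forall y, A y -> B y || C y) ->
  density A <= density B + density C.
Proof.
move=> ABC; rewrite -mulrDl ler_pM2r ?invr_gt0 ?gridM_gt0// -natrD ler_nat.
apply: leq_trans (_ : #|[predU B & C]| <= _)%N; last first.
  by rewrite -cardUI leq_addr.
by apply: subset_leq_card; apply/fintype.subsetP => y; exact: ABC.
Qed.

(** Two points of a line that both lie in the shell of radii r and r + w: u and v
    are their moving coordinates, sg is the sum of the squares of the other
    coordinates, and D bounds the dimension. If r <= w then v is itself at most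
    2 w; otherwise u is at least r / D, because it carries a fraction 1 / D of the
    squared norm, and (v - u) (v + u) <= 3 r w bounds v - u. *)
Lemma quadratic_gap (D r w sg u v : R) : 1 <= D -> 0 <= r -> 0 <= w -> 0 <= u -> 0 <= v ->
  r ^+ 2 <= sg + u ^+ 2 -> sg + u ^+ 2 <= D * u ^+ 2 -> 0 <= sg ->
  sg + v ^+ 2 <= (r + w) ^+ 2 -> v - u <= 2 * D * w.
Proof.
move=> D1 r0 w0 u0 v0 ru uD sg0 vw.
have vrw : v <= r + w.
  by rewrite -(ler_pXn2r (n := 2)) ?nnegrE ?addr_ge0//; lra.
have [rw|wr] := leP r w; first by nra.
have rDu : r <= D * u.
  rewrite -(ler_pXn2r (n := 2)) ?nnegrE ?mulr_ge0//; last by lra.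
  by rewrite exprMn; have := sqr_ge0 u; nra.
rewrite leNgt; apply/negP => gap.
have h1 : (v - u) * (v + u) <= 3 * r * w by nra.
have h2 : 2 * D * w * u <= (v - u) * u by rewrite ler_wpM2r// ltW.
have h3 : 2 * r * w <= 2 * D * w * u by nra.
have Dw0 : 0 <= 2 * D * w by rewrite mulr_ge0// mulr_ge0//; lra.
have h4 : 2 * D * w * (2 * D * w) <= (v - u) * (v - u).
  by apply: ler_pM => //; lra.
have h5 : 0 < (v - u) * (v + u) by apply: mulr_gt0; lra.
have h6 : 0 <= 2 * D * w * (2 * D * w) by rewrite -expr2 sqr_ge0.
have h7 : (v - u) * (v + u) = 2 * ((v - u) * u) + (v - u) * (v - u) by ring.
have h8 : 0 <= r * w by exact: mulr_ge0.
lra.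
Qed.

(** At the points counted here, coordinate j carries at least the fraction 1 / d of
    the squared norm, so the sphere is transverse to the axis j. *)
Lemma card_shell_line j (r w : R) y : 0 <= r -> 0 <= w ->
  #|[pred t | shell r (r + w) (y + axis j t) &&
      (dist_norm (y + axis j t) ^+ 2 <=
        d%:R * distZ (((y + axis j t)%R j)%:R / M%:R : R) ^+ 2)]|%:R
    <= 2 * (2 * d%:R * w * M%:R + 1) :> R.
Proof.
move=> r0 w0.
have d1 : (1 : R) <= d%:R by rewrite ler1n; case: (d) j => // -[].
pose A := [pred t : 'I_M | shell r (r + w) (y + axis j (t - y j)) &&
      (dist_norm (y + axis j (t - y j)) ^+ 2 <=
        d%:R * distZ (t%:R / M%:R : R) ^+ 2)].
apply: le_trans (_ : #|A|%:R <= _).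
  rewrite ler_nat -(card_imset _ (@addrI _ (y j : 'I_M))); apply: subset_leq_card.
  apply/fintype.subsetP => _ /imsetP[t At ->]; move: At; rewrite !inE.
  by rewrite [y j + t - y j]addrC addKr !ffunE eqxx.
apply: card_close_dist; first by rewrite !mulr_ge0.
pose sg := \sum_(i | i != j) distZ ((y i)%:R / M%:R : R) ^+ 2.
have dE (t : 'I_M) : dist_norm (y + axis j (t - y j)) ^+ 2 =
    sg + distZ (t%:R / M%:R : R) ^+ 2.
  rewrite dist_norm_sqr (bigD1 j)//= addrC; congr (_ + _).
    by apply: eq_bigr => i ij; rewrite !ffunE (negbTE ij) addr0.
  by rewrite !ffunE eqxx addrC subrK.
have sg0 : 0 <= sg by apply: sumr_ge0 => i _; exact: sqr_ge0.
have gap (t u : 'I_M) : t \in A -> u \in A ->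
    distZ (u%:R / M%:R : R) - distZ (t%:R / M%:R : R) <= 2 * d%:R * w.
  rewrite !inE => /andP[/andP[rt _]]; rewrite dE => td /andP[/andP[_ ur] _].
  apply: (quadratic_gap d1 r0 w0 (distZ_ge0 _) (distZ_ge0 _) _ td sg0).
    by rewrite -dE lerXn2r ?nnegrE ?dist_norm_ge0.
  by rewrite -dE lerXn2r ?nnegrE ?dist_norm_ge0// addr_ge0.
move=> t u At Au; rewrite ler_norml lerNl opprB.
by rewrite !gap.
Qed.

(** Each point of the shell has a largest coordinate j; slicing along the axis j
    gives the bound. A negative r reduces to r = 0. *)
Lemma density_shell (r w : R) : (0 < d)%N -> 0 <= w ->
  density (shell r (r + w)) <= 4 * d%:R ^+ 2 * (w + M%:R^-1).
Proof.
move=> d0 w0; wlog r0 : r / 0 <= r => [wl|].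
  have [|r0] := leP 0 r; first exact: wl.
  apply: le_trans (wl 0 _) => //; apply: density_sub => y /andP[y1 y2].
  by rewrite /shell /= dist_norm_ge0 (le_trans y2)// add0r; lra.
pose big j y := shell r (r + w) y &&
  (dist_norm y ^+ 2 <= d%:R * distZ ((y j)%:R / M%:R : R) ^+ 2).
have cover y : shell r (r + w) y -> exists j, big j y.
  move=> ry; pose f (i : 'I_d) := distZ ((y i)%:R / M%:R : R).
  have [j _ jmax] := @Order.TotalTheory.arg_maxP _ _ _ (Ordinal d0) predT f isT.
  exists j; rewrite /big ry dist_norm_sqr /=.
  apply: le_trans (_ : \sum_(i < d) f j ^+ 2 <= _); last first.
    by rewrite sumr_const card_ord mulr_natl.
  by apply: ler_sum => i _; rewrite lerXn2r ?nnegrE ?distZ_ge0//; exact: jmax.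
have M0 : 0 < M%:R :> R by rewrite ltr0n.
rewrite /density ler_pdivrMr ?gridM_gt0// -(ler_pM2r M0).
apply: le_trans (_ : (\sum_j #|[pred y | big j y]|%:R) * M%:R <= _).
  rewrite ler_pM2r// natr_card; under [leRHS]eq_bigr do rewrite natr_card.
  rewrite exchange_big /=; apply: ler_sum => y _.
  have [/cover[j bj]|_] := boolP (shell _ _ y); last by apply: sumr_ge0.
  by rewrite (bigD1 j)//= bj lerDl sumr_ge0.
rewrite mulr_suml.
apply: le_trans (_ : \sum_(j < d) 2 * (2 * d%:R * w * M%:R + 1) * M%:R ^+ d <= _).
  apply: ler_sum => j _; apply: (@card_by_lines _ j) => y.
  exact: card_shell_line.
rewrite sumr_const card_ord -[_ *+ d]mulr_natl.
rewrite [leRHS]mulrAC [leLHS]mulrA ler_pM2r ?gridM_gt0//.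
have -> : 4 * d%:R ^+ 2 * (w + M%:R^-1) * M%:R = d%:R * (4 * d%:R * w * M%:R + 4 * d%:R).
  by rewrite mulrDr mulrDl mulrA mulfVK ?gt_eqF//; ring.
have d1 : (1 : R) <= d%:R by rewrite ler1n.
by apply: ler_wpM2l => //; lra.
Qed.

End shells.

Section shell_bounds.
Context {R : realType} {d m : nat}.
Local Notation M := m.+1.
Local Notation grid := {ffun 'I_d -> 'I_m.+1}.
Implicit Types (y h : grid) (j : 'I_d) (t : 'I_m.+1) (a b r w : R).

(** A translation by h changes the torus norm by at most w, so membership can only
    change within distance w of one of the two bounding spheres. This bounds the
    L2 modulus of continuity of the indicator of a shell. *)
Lemma density_boundary a b w h : (0 < d)%N -> 0 <= w ->
  \sum_i distZ (grid_pt h 0 i : R) <= w ->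
  density [pred y | shell a b (y + h) != shell a b y]
    <= 8 * d%:R ^+ 2 * (2 * w + M%:R^-1).
Proof.
move=> d0 w0 hw.
have lip y : `|dist_norm (y + h) - dist_norm y| <= w :> R.
  rewrite /dist_norm; have -> : tnorm (grid_pt (y + h) : 'rV[R]_d) =
      tnorm (grid_pt y + grid_pt h : 'rV[R]_d).
    by apply: eq_tnorm => i; rewrite [(grid_pt y + _) 0 i]mxE; exact: distZ_gridD.
  apply: le_trans (tnorm_lipschitz _ _) (le_trans _ hw); apply: ler_sum => i _.
  by rewrite [(grid_pt y + _) 0 i]mxE [_ + grid_pt h 0 i]addrC addrK.
have ww : 0 <= 2 * w by rewrite mulr_ge0.
have -> : 8 * d%:R ^+ 2 * (2 * w + M%:R^-1) =
  4 * d%:R ^+ 2 * (2 * w + M%:R^-1) + 4 * d%:R ^+ 2 * (2 * w + M%:R^-1) :> R by ring.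
apply: le_trans (lerD (density_shell (m := m) (a - w) d0 ww)
                      (density_shell (m := m) (b - w) d0 ww)).
apply: densityU => y /=; have := lip y; rewrite ler_norml => /andP[].
set u := dist_norm (y + h); set v := dist_norm y => uv vu.
rewrite /shell /= -/u -/v.
have [av|va] := leP (a - w) v => /=; last first.
  have -> : (a <= v) = false by apply/negbTE; rewrite -ltNge; lra.
  have -> // : (a <= u) = false by apply/negbTE; rewrite -ltNge; lra.
have [va|{}av] := leP v (a - w + 2 * w) => //=.
have -> : a <= v by lra.
have -> : a <= u by lra.
rewrite /=; have [bv|bv] := leP (b - w) v => /=; last first.
  have -> : v <= b by lra.
  by have -> : u <= b by lra.
have [//|vb] := leP v (b - w + 2 * w).
have -> : (v <= b) = false by apply/negbTE; rewrite -ltNge; lra.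
by have -> // : (u <= b) = false by apply/negbTE; rewrite -ltNge; lra.
Qed.

Lemma card_ord_interval k l (A : pred 'I_M) : (l <= M)%N ->
  (forall t, (k <= t < l)%N -> A t) -> (l - k <= #|A|)%N.
Proof.
move=> lM At.
have lt_i (i : 'I_(l - k)) : (k + i < M)%N.
  by apply: leq_trans lM; rewrite -ltn_subRL.
pose f (i : 'I_(l - k)) : 'I_M := Ordinal (lt_i i).
have f_inj : injective f by move=> i i' /(congr1 val) /= /addnI /val_inj.
rewrite -[(l - k)%N]card_ord -(card_imset _ f_inj); apply: subset_leq_card.
apply/fintype.subsetP => _ /imsetP[i _ ->]; apply: At.
by rewrite /= leq_addr -ltn_subRL ltn_ord.
Qed.

(** If all the other coordinates are small compared to a, the admissible values of
    the first one fill the interval between sqrt (a^2 - sg) and sqrt (b^2 - sg),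
    whose length is at least b - a. *)
Lemma density_shell_ge a b : (0 < d)%N -> 1 / 100 <= a -> a <= b -> b < 1 / 2 ->
  (200 * d%:R)^-1 ^+ d * (b - a - M%:R^-1) <= density (@shell R d m a b).
Proof.
move=> d0 a0 ab b2; pose j := Ordinal d0.
have d1 : (1 : R) <= d%:R by rewrite ler1n.
have M0 : 0 < M%:R :> R by rewrite ltr0n.
have [small|big] := leP (b - a) M%:R^-1.
  apply: le_trans (density_ge0 _).
  by rewrite mulr_ge0_le0 ?exprn_ge0 ?invr_ge0 ?mulr_ge0// subr_le0.
(* Coordinates up to 1 / (200 d) have a sum of squares of at most (1 / 200)^2. *)
pose s := M%:R / (200 * d%:R) : R.
have s0 : 0 <= s by rewrite divr_ge0// mulr_ge0.
have sM : s < M%:R by rewrite ltr_pdivrMr; nra.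
have /andP[s1 s2] := truncn_itv s0.
pose A := [pred y : grid | [forall i, (y i <= Num.truncn s)%N]].
have cardA : s ^+ d <= #|A|%:R.
  have -> : #|A| = #|(ffun_on [pred t : 'I_M | (t <= Num.truncn s)%N] : {pred grid})|.
    by apply: eq_card => y; apply/forallP/ffun_onP => yA i; exact: yA.
  rewrite card_ffun_on card_ord natrX lerXn2r ?nnegrE//.
  apply: le_trans (ltW s2) _; rewrite ler_nat -[(_.+1)%N]subn0.
  by apply: card_ord_interval => // ; rewrite -(ltr_nat R) (le_lt_trans s1).
have line y : A y -> (b - a) * M%:R - 1 <=
    #|[pred t | @shell R d m a b (y + axis j t)]|%:R.
  move=> /forallP yA.
  pose sg := \sum_(i | i != j) distZ ((y i)%:R / M%:R : R) ^+ 2.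
  have sg0 : 0 <= sg by apply: sumr_ge0 => i _; exact: sqr_ge0.
  have sga : sg <= (1 / 200) ^+ 2.
    apply: le_trans (_ : \sum_(i < d) ((200 * d%:R)^-1) ^+ 2 <= _).
      rewrite /sg big_mkcond /=; apply: ler_sum => i _; case: ifP => _; last exact: sqr_ge0.
      rewrite lerXn2r ?nnegrE ?distZ_ge0 ?invr_ge0 ?mulr_ge0//.
      apply: le_trans (distZ_le_norm _) _; rewrite ger0_norm ?divr_ge0//.
      rewrite ler_pdivrMr// mulrC; apply: le_trans s1; by rewrite ler_nat.
    rewrite sumr_const card_ord -[_ *+ d]mulr_natr.
    have -> : (200 * d%:R)^-1 ^+ 2 * d%:R = (1 / 200) ^+ 2 * d%:R^-1 :> R.
      by field; rewrite gt_eqF// ltr0n.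
    by rewrite ler_piMr ?sqr_ge0// invf_le1 ?ltr0n.
  pose u := Num.sqrt (a ^+ 2 - sg); pose v := Num.sqrt (b ^+ 2 - sg).
  have a2sg : 0 <= a ^+ 2 - sg.
    by rewrite subr_ge0; apply: le_trans sga _; rewrite lerXn2r ?nnegrE//; lra.
  have b2sg : 0 <= b ^+ 2 - sg.
    by apply: le_trans a2sg _; rewrite lerD2r lerXn2r ?nnegrE//; lra.
  have u0 : 0 <= u by exact: sqrtr_ge0.
  have v0 : 0 <= v by exact: sqrtr_ge0.
  have uu : u ^+ 2 = a ^+ 2 - sg by rewrite sqr_sqrtr.
  have vv : v ^+ 2 = b ^+ 2 - sg by rewrite sqr_sqrtr.
  have ua : u <= a by rewrite -(ler_pXn2r (n := 2)) ?nnegrE//; lra.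
  have vb : v <= b by rewrite -(ler_pXn2r (n := 2)) ?nnegrE//; lra.
  have vu : b - a <= v - u by nra.
  have uM0 : 0 <= u * M%:R by rewrite mulr_ge0// ltW.
  have vM0 : 0 <= v * M%:R by rewrite mulr_ge0// ltW.
  have /andP[u1 u2] := truncn_itv uM0; have /andP[v1 v2] := truncn_itv vM0.
  set ku := Num.truncn (u * M%:R) in u1 u2; set kv := Num.truncn (v * M%:R) in v1 v2.
  have kvM : (kv < M)%N by rewrite -(ltr_nat R); nra.
  pose B := [pred t : 'I_M | @shell R d m a b (y + axis j (t - y j))].
  apply: le_trans (_ : #|B|%:R <= _); last first.
    rewrite ler_nat -(card_imset _ (@addIr _ (- y j : 'I_M))); apply: subset_leq_card.
    by apply/fintype.subsetP => _ /imsetP[t Bt ->]; move: Bt; rewrite !inE.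
  apply: le_trans (_ : (kv.+1 - ku.+1)%:R <= _); last first.
    rewrite ler_nat; apply: card_ord_interval => // t /andP[kt tk].
    have tM : u * M%:R <= t%:R <= v * M%:R.
      rewrite (le_trans (ltW u2)) ?ler_nat//= (le_trans _ v1)// ler_nat -ltnS//.
    have dt : distZ (t%:R / M%:R : R) = t%:R / M%:R.
      rewrite distZ_frac ?(ltnW (ltn_ord t))// min_l//.
      by case/andP: tM => _ tM; nra.
    have dE : @dist_norm R d m (y + axis j (t - y j)) ^+ 2 = sg + (t%:R / M%:R) ^+ 2.
      rewrite dist_norm_sqr (bigD1 j)//= addrC; congr (_ + _).
        by apply: eq_bigr => i ij; rewrite !ffunE (negbTE ij) addr0.
      by rewrite !ffunE eqxx addrC subrK dt.
    have tuv : u <= t%:R / M%:R <= v.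
      by rewrite ler_pdivlMr// ler_pdivrMr.
    case/andP: tuv => tu tv.
    rewrite inE /=; apply/andP; split.
      rewrite -(ler_pXn2r (n := 2)) ?nnegrE ?dist_norm_ge0//; last by lra.
      by rewrite dE -lerBlDl -uu lerXn2r ?nnegrE ?divr_ge0.
    rewrite -(ler_pXn2r (n := 2)) ?nnegrE ?dist_norm_ge0//; last by lra.
    by rewrite dE -lerBrDl -vv lerXn2r ?nnegrE ?divr_ge0.
  rewrite subSS; have [kuv|kuv] := leqP ku kv.
    by rewrite natrB//; rewrite -[kv.+1%:R]natr1 in v2; nra.
  have : kv.+1%:R <= ku%:R :> R by rewrite ler_nat.
  rewrite -[kv.+1%:R]natr1 => kuv'; rewrite -[kv.+1%:R]natr1 in v2.
  apply: le_trans (ler0n _ _).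
  by nra.
rewrite /density ler_pdivlMr ?gridM_gt0// -(ler_pM2r M0).
rewrite [leRHS]mulrC natr_card (sum_lines (fun y => (shell a b y)%:R) j).
have bM : 0 <= (b - a) * M%:R - 1.
  by rewrite subr_ge0 -ler_pdivrMr// div1r ltW.
apply: le_trans (_ : \sum_(y : grid) (A y)%:R * ((b - a) * M%:R - 1) <= _); last first.
  apply: ler_sum => y _; case: (boolP (A y)) => Ay /=.
    by rewrite mul1r; have := line _ Ay; rewrite natr_card.
  by rewrite mul0r sumr_ge0.
rewrite -mulr_suml -natr_card.
have -> : (200 * d%:R)^-1 ^+ d * (b - a - M%:R^-1) * M%:R ^+ d * M%:R =
   s ^+ d * ((b - a) * M%:R - 1).
  rewrite /s exprMn [_ * _ * M%:R ^+ d]mulrAC [_ ^+ d * M%:R ^+ d]mulrC -mulrA.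
  by congr (_ * _); rewrite mulrBl mulVf// gt_eqF.
by rewrite ler_wpM2r.
Qed.

End shell_bounds.

(** * Comparing Lebesgue measure with grid counts *)

Section volume.
Context {R : realType}.
Local Notation mR := (measurableTypeR R).
Local Open Scope classical_set_scope.

Lemma measure_bigsetU_le dsp (T : measurableType dsp) (mu : {measure set T -> \bar R})
    (I : Type) (s : seq I) (P : pred I) (F : I -> set T) :
  (forall i, measurable (F i)) ->
  (mu (\big[setU/set0]_(i <- s | P i) F i) <= \sum_(i <- s | P i) mu (F i))%E.
Proof.
move=> mF.
suff [] : measurable (\big[setU/set0]_(i <- s | P i) F i) /\
  (mu (\big[setU/set0]_(i <- s | P i) F i) <= \sum_(i <- s | P i) mu (F i))%E by [].
elim/big_rec2: _ => [|i x A _ [mA Ax]]; first by rewrite measure0.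
split; first exact: measurableU.
by apply: le_trans (measureU2 _ _ _) _ => //; exact: leeD.
Qed.

Variables (d m : nat).
Local Notation M := m.+1.
Local Notation grid := {ffun 'I_d -> 'I_m.+1}.
Local Notation T := (d.-tuple mR).
Local Notation mu2 := (lebesgue_tuple d \x lebesgue_tuple d)%E.

Lemma measurable_tuple_box (A : 'I_d -> set mR) : (forall i, measurable (A i)) ->
  measurable [set t : T | forall i, A i (tnth t i)].
Proof.
move=> mA; rewrite (_ : [set t : T | _] =
    \bigcap_(i in [set: 'I_d]) ((fun t => tnth t i) @^-1` A i)).
  apply: fin_bigcap_measurable => // i _.
  by rewrite -[_ @^-1` _]setTI; exact: measurable_tnth.
by apply/seteqP; split => t /= H i; [move=> _; exact: H|exact: H].
Qed.

Definition cell_side (y : grid) (i : 'I_d) : set mR :=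
  `[(y i)%:R / M%:R, (y i).+1%:R / M%:R].

Definition cell (y : grid) : set T := [set t | forall i, cell_side y i (tnth t i)].

Lemma measurable_cell y : measurable (cell y).
Proof. by apply: (@measurable_tuple_box (cell_side y)) => i; exact: measurable_itv. Qed.

Lemma prode_EFin (I : Type) (s : seq I) (P : pred I) (F : I -> R) :
  (\prod_(i <- s | P i) (F i)%:E = (\prod_(i <- s | P i) F i)%:E)%E.
Proof. by elim/big_rec2: _ => // i x y _ ->; rewrite EFinM. Qed.

Lemma cell_volume y : lebesgue_tuple d (cell y) = (M%:R ^- d)%:E.
Proof.
rewrite /cell (@lebesgue_tuple_box _ _ (cell_side y)); last by move=> i; exact: measurable_itv.
have M0 : 0 < M%:R :> R by rewrite ltr0n.
rewrite (eq_bigr (fun=> (M%:R^-1)%:E)) => [|i _].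
  by rewrite prode_EFin prodr_const card_ord exprVn.
rewrite /cell_side lebesgue_measure_itv /= lte_fin ltr_pM2r ?invr_gt0// ltr_nat ltnSn.
by rewrite -EFinB -mulrBl -natr1 [_ + 1]addrC addrK mul1r.
Qed.

Definition cube : set T := [set t | unit_cube (row_of_tuple t)].

Lemma cubeE : cube = [set t | forall i, `[0, 1]%classic (tnth t i)].
Proof.
by apply/seteqP; split => t H i; have := H i; rewrite /= mxE /= in_itv.
Qed.

Lemma measurable_cube : measurable cube.
Proof.
rewrite cubeE; apply: (@measurable_tuple_box (fun=> `[0, 1])) => i.
exact: measurable_itv.
Qed.

Lemma cube_volume : lebesgue_tuple d cube = 1%E.
Proof.
rewrite cubeE (@lebesgue_tuple_box _ _ (fun=> `[0, 1])); last by move=> i; exact: measurable_itv.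
rewrite big1// => i _.
by rewrite lebesgue_measure_itv /= lte_fin ltr01 sube0.
Qed.

Lemma cube_cell t : cube t -> exists y, cell y t.
Proof.
move=> ct; have M0 : 0 < M%:R :> R by rewrite ltr0n.
pose k i := Num.truncn (tnth t i * M%:R).
exists [ffun i => inord (minn (k i) m)] => i; rewrite /cell_side /= !ffunE in_itv /=.
have := ct i; rewrite mxE => /andP[t0 t1].
rewrite inordK ?ltnS ?geq_minr// ler_pdivrMr// ler_pdivlMr//.
have /andP[k1 k2] : (k i)%:R <= tnth t i * M%:R < (k i).+1%:R.
  by apply: truncn_itv; rewrite mulr_ge0// ltW.
apply/andP; split.
  by apply: le_trans k1; rewrite ler_nat geq_minl.
rewrite /minn; case: ifP => _; first exact: ltW.
by rewrite ler_piMl// ltW.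
Qed.

(** The closed cells meeting S cover it; their overlaps can only increase the bound.
    Lower bounds come from applying this to the complement of S. *)
Lemma volume_le_cells (S : set (T * T)) (P : pred (grid * grid)) :
  measurable S -> S `<=` cube `*` cube ->
  (forall y z t u, cell y t -> cell z u -> S (t, u) -> P (y, z)) ->
  (mu2 S <= (#|P|%:R / (M%:R ^+ d * M%:R ^+ d))%:E)%E.
Proof.
move=> mS Scube SP.
pose F (p : grid * grid) := cell p.1 `*` cell p.2.
have mF p : measurable (F p) by apply: measurableX; exact: measurable_cell.
apply: (@le_trans _ _ (mu2 (\big[setU/set0]_(p in P) F p))).
  apply: le_measure; rewrite ?inE//.
    by apply: bigsetU_measurable.
  move=> [t u] Stu; have [/= /cube_cell[y yt] /cube_cell[z zu]] := Scube _ Stu.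
  by rewrite -bigcup_pred; exists (y, z) => //=; exact: (SP y z t u).
apply: le_trans (measure_bigsetU_le _ _ _ mF) _.
rewrite (eq_bigr (fun=> (M%:R ^- d * M%:R ^- d)%:E)) => [|p _].
  rewrite sumEFin lee_fin sumr_const -[leLHS]mulr_natl invfM.
  by [].
apply: etrans (product_measure1E _ _ _ _) _; [exact: measurable_cell..|].
by rewrite EFinM; congr (_ * _)%E; exact: cell_volume.
Qed.


Definition torus2_region (S : set ('rV[R]_d * 'rV[R]_d)) : set (T * T) :=
  [set p | let x := row_of_tuple p.1 in let y := row_of_tuple p.2 in
             [/\ unit_cube x, unit_cube y & S (x, y)]].

(* On the unit cube the differences of coordinates lie in [-1, 1], where the
   distance to the integers is an explicit measurable function. *)
Let gap2 (p : T * T) : R :=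
  \sum_(i < d) Num.min `|tnth p.1 i - tnth p.2 i| (1 - `|tnth p.1 i - tnth p.2 i|) ^+ 2.

Lemma measurable_gap2 : measurable_fun setT gap2.
Proof.
apply: measurable_sum => i; apply: measurable_funX.
have mu : measurable_fun setT (fun p : T * T => `|tnth p.1 i - tnth p.2 i|).
  apply: (measurableT_comp (normr_measurable (D := setT))).
  apply: measurable_funB.
    exact: (measurableT_comp (measurable_tnth i)).
  exact: (measurableT_comp (measurable_tnth i)).
by apply: measurable_minr => //; apply: measurable_funB.
Qed.

Lemma tnorm_gap2 (p : T * T) : cube p.1 -> cube p.2 ->
  tnorm (row_of_tuple p.1 - row_of_tuple p.2) = Num.sqrt (gap2 p).
Proof.
move=> c1 c2; rewrite tnormE; congr Num.sqrt; apply: eq_bigr => i _.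
have := c1 i; have := c2 i; rewrite !mxE => /andP[u0 u1] /andP[t0 t1].
by rewrite distZ_unit// ler_norml; apply/andP; split; lra.
Qed.

Lemma torus2_regionE a b : torus2_region (Omega a b) =
  (cube `*` cube) `&` ((Num.sqrt \o gap2) @^-1` `[a, b]).
Proof.
apply/seteqP; split => p /=.
  by move=> [c1 c2]; rewrite /Omega /= tnorm_gap2// in_itv.
by move=> [[c1 c2]]; rewrite in_itv /= => ab; split => //; rewrite /Omega /= tnorm_gap2.
Qed.

Lemma measurable_torus2_region a b : measurable (torus2_region (Omega a b)).
Proof.
rewrite torus2_regionE; apply: measurableI.
  by apply: measurableX; exact: measurable_cube.
rewrite -[_ @^-1` _]setTI.
suff mf : measurable_fun setT (Num.sqrt \o gap2).
  by apply: mf => //; exact: measurable_itv.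
apply: measurableT_comp measurable_gap2.
by apply: continuous_measurable_fun; exact: sqrt_continuous.
Qed.

Lemma cell_dist (y z : grid) (t u : T) : cell y t -> cell z u ->
  `|tnorm (row_of_tuple t - row_of_tuple u) - dist_norm (y - z)| <= d%:R / M%:R.
Proof.
move=> yt zu.
have M0 : 0 < M%:R :> R by rewrite ltr0n.
have -> : dist_norm (y - z) = tnorm (grid_pt y - grid_pt z : 'rV[R]_d).
  apply: eq_tnorm => i.
  have -> : (grid_pt y - grid_pt z : 'rV[R]_d) 0 i =
      grid_pt (y - z + z) 0 i - grid_pt z 0 i by rewrite subrK [LHS]mxE [(- grid_pt z) 0 i]mxE.
  have [n ->] := grid_ptD (R := R) (y - z) z i.
  by rewrite [_ + grid_pt z 0 i + _]addrAC addrK distZDz.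
apply: le_trans (tnorm_lipschitz _ _) _.
apply: le_trans (_ : \sum_(i < d) M%:R^-1 <= _); last first.
  by rewrite sumr_const card_ord mulr_natl.
apply: ler_sum => i _; apply: le_trans (distZ_le_norm _) _.
have := yt i; have := zu i; rewrite /cell_side /= !in_itv /= !mxE -![_.+1%:R]natr1 !mulrDl mul1r.
by move=> /andP[z1 z2] /andP[y1 y2]; rewrite ler_norml; apply/andP; split; lra.
Qed.

Lemma card_pairs (A : pred grid) :
  #|[pred p : grid * grid | A (p.1 - p.2)]|%:R = M%:R ^+ d * #|A|%:R :> R.
Proof.
rewrite !natr_card -(pair_bigA _ (fun y z : grid => (A (y - z))%:R)) /= exchange_big /=.
rewrite (eq_bigr (fun=> \sum_(y : grid) (A y)%:R)) => [|z _].
  by rewrite sumr_const card_ffun !card_ord -natrX mulr_natl.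
by rewrite [RHS](reindex_inj (@addIr _ (- z))).
Qed.

Lemma volume_le_density (S : set (T * T)) (A : pred grid) :
  measurable S -> S `<=` cube `*` cube ->
  (forall y z t u, cell y t -> cell z u -> S (t, u) -> A (y - z)) ->
  (mu2 S <= (density A)%:E)%E.
Proof.
move=> mS Sc SA; apply: le_trans (@volume_le_cells S [pred p | A (p.1 - p.2)] mS Sc _) _.
  by move=> y z t u yt zu Stu /=; exact: SA yt zu Stu.
rewrite card_pairs lee_fin /density -mulf_div divff ?mul1r// gt_eqF// gridM_gt0.
Qed.

(** Upper bound: cover the region by pairs of cells. Lower bound: cover its
    complement in the cube, which has total volume one. *)
Lemma torus2_volume_sandwich a b (w : R) : w = d%:R / M%:R ->
  density (@shell R d m (a + w) (b - w)) <= torus2_volume (@Omega R d a b)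
    <= density (@shell R d m (a - w) (b + w)).
Proof.
move=> wE; pose S := torus2_region (Omega a b).
have mS : measurable S by exact: measurable_torus2_region.
have mC : measurable (cube `*` cube : set (T * T)).
  by apply: measurableX; exact: measurable_cube.
have SC : S `<=` cube `*` cube by move=> [t u] [].
have upper : (mu2 S <= (density (@shell R d m (a - w) (b + w)))%:E)%E.
  apply: volume_le_density => // y z t u yt zu [_ _]; rewrite /Omega /shell /=.
  have := cell_dist yt zu; rewrite -wE ler_norml => /andP[? ?] /andP[? ?].
  by apply/andP; split; lra.
have lower : (mu2 ((cube `*` cube) `\` S) <=
    (density (predC (@shell R d m (a + w) (b - w))))%:E)%E.
  apply: volume_le_density => //; first exact: measurableD.
  move=> y z t u yt zu [[/= ct cu] nS]; apply/negP => /andP[yz1 yz2]; apply: nS.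
  split => //; rewrite /Omega /=.
  have := cell_dist yt zu; rewrite -wE ler_norml => /andP[? ?].
  by apply/andP; split; lra.
have Cvol : mu2 (cube `*` cube) = 1%E.
  apply: etrans (product_measure1E _ _ _ _) _; [exact: measurable_cube..|].
  by rewrite -[RHS]mule1; congr (_ * _)%E; exact: cube_volume.
have Sfin : mu2 S \is a fin_num.
  by rewrite ge0_fin_numE// (le_lt_trans upper)// ltry.
have VE : (torus2_volume (@Omega R d a b))%:E = mu2 S by rewrite -(fineK Sfin).
apply/andP; split; last by rewrite -lee_fin VE.
have dC : density (predC (@shell R d m (a + w) (b - w))) =
    1 - density (@shell R d m (a + w) (b - w)) :> R.
  have Md : M%:R ^+ d != 0 :> R by rewrite gt_eqF ?gridM_gt0.
  apply: (mulIf Md); rewrite mulrBl mul1r !divfK//.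
  rewrite -natrX -[in RHS](_ : #|{: grid}| = M ^ d)%N; last by rewrite card_ffun !card_ord.
  by rewrite -(cardC (@shell R d m (a + w) (b - w))) [in RHS]natrD [X in _ = X - _]addrC addrK.
have CS : mu2 ((cube `*` cube) `\` S) = (1 - torus2_volume (@Omega R d a b))%:E.
  apply: etrans (measureD mC mS _) _.
    by apply: (@eq_ind_r _ _ (fun x => x < +oo)%E _ _ Cvol); exact: ltry.
  rewrite EFinB; congr (_ - _)%E; first exact: Cvol.
  by rewrite setIidr//; exact: esym VE.
by move: lower; rewrite CS lee_fin dC; lra.
Qed.

End volume.

Section volume_density.
Context {R : realType} {d : nat}.

Lemma density_shell_widen m (a b w : R) : (0 < d)%N -> 0 <= w ->
  density (@shell R d m (a - w) (b + w)) <=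
  density (@shell R d m a b) + 8 * d%:R ^+ 2 * (w + m.+1%:R^-1).
Proof.
move=> d0 w0.
pose B := [predU @shell R d m (a - w) (a - w + w) & @shell R d m b (b + w)].
apply: (@le_trans _ _ (density (@shell R d m a b) + density B)).
  apply: densityU => y; rewrite /B /shell /= => /andP[y1 y2].
  have [ya|ya] := leP a (dist_norm y); have [yb|yb] := leP (dist_norm y) b => //=.
  - by apply/orP; right; apply/andP; split; lra.
  - by apply/orP; left; apply/andP; split; lra.
  - by apply/orP; left; apply/andP; split; lra.
rewrite lerD2l.
apply: le_trans (densityU (B := shell (a - w) (a - w + w)) (C := shell b (b + w)) _) _ => //.
have h1 := @density_shell R d m (a - w) w d0 w0; have h2 := @density_shell R d m b w d0 w0.
have -> : 8 * d%:R ^+ 2 * (w + m.+1%:R^-1) =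
  4 * d%:R ^+ 2 * (w + m.+1%:R^-1) + 4 * d%:R ^+ 2 * (w + m.+1%:R^-1) :> R by ring.
exact: lerD.
Qed.

(** Both bounds of the sandwich differ from the count by thin shells of width d / M. *)
Lemma torus2_volume_density m (a b : R) : (0 < d)%N ->
  `|torus2_volume (@Omega R d a b) - density (@shell R d m a b)| <=
    8 * d%:R ^+ 2 * (d%:R + 1) / m.+1%:R.
Proof.
move=> d0; pose w : R := d%:R / m.+1%:R.
have w0 : 0 <= w by rewrite divr_ge0.
have /andP[lo up] := torus2_volume_sandwich (d := d) (m := m) a b (erefl w).
have h1 := density_shell_widen m a b d0 w0.
have := density_shell_widen m (a + w) (b - w) d0 w0; rewrite addrK subrK => h2.
have -> : 8 * d%:R ^+ 2 * (d%:R + 1) / m.+1%:R = 8 * d%:R ^+ 2 * (w + m.+1%:R^-1) :> R.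
  by rewrite /w; move: (m.+1%:R^-1) => i; ring.
move: lo up h1 h2; move: (8 * _ * _) (torus2_volume _) (density (shell a b)).
move: (density _) (density _) => D1 D2 K V D lo up h1 h2.
by rewrite ler_norml; apply/andP; split; lra.
Qed.

(** Letting M grow, the volume inherits the bounds proved for grid counts. *)
Lemma torus2_volume_le (a b : R) : (0 < d)%N -> a <= b ->
  torus2_volume (@Omega R d a b) <= 4 * d%:R ^+ 2 * (b - a).
Proof.
move=> d0 ab; apply/ler_addgt0Pr => e e0.
pose K : R := 8 * d%:R ^+ 2 * (d%:R + 1) + 4 * d%:R ^+ 2.
have K0 : 0 <= K by rewrite addr_ge0 ?mulr_ge0 ?addr_ge0 ?exprn_ge0.
(* A grid fine enough for all terms of order 1 / M to add up to at most e. *)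
pose m := Num.truncn (K / e).
have Km : K / m.+1%:R <= e.
  by rewrite ler_pdivrMr ?ltr0n// mulrC -ler_pdivrMr// ltW// truncnS_gt.
have := torus2_volume_density m a b d0; rewrite ler_norml => /andP[_ h].
have ba : 0 <= b - a by rewrite subr_ge0.
have := density_shell (m := m) a d0 ba; rewrite [a + _]addrC subrK => h2.
move: Km h h2; rewrite /K; move: (torus2_volume _) (density _) => V D.
by move: (m.+1%:R^-1) => i; rewrite mulrDl; lra.
Qed.

Lemma torus2_volume_ge (a b : R) : (0 < d)%N -> 1 / 100 <= a -> a <= b -> b < 1 / 2 ->
  (200 * d%:R)^-1 ^+ d * (b - a) <= torus2_volume (@Omega R d a b).
Proof.
move=> d0 a0 ab b2; apply/ler_addgt0Pr => e e0.
pose c : R := (200 * d%:R)^-1 ^+ d.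
have c0 : 0 <= c by rewrite exprn_ge0 ?invr_ge0 ?mulr_ge0.
pose K : R := 8 * d%:R ^+ 2 * (d%:R + 1) + c.
have K0 : 0 <= K by rewrite addr_ge0 ?mulr_ge0 ?addr_ge0 ?exprn_ge0.
pose m := Num.truncn (K / e).
have Km : K / m.+1%:R <= e.
  by rewrite ler_pdivrMr ?ltr0n// mulrC -ler_pdivrMr// ltW// truncnS_gt.
have := torus2_volume_density m a b d0; rewrite ler_norml => /andP[h _].
have := density_shell_ge (m := m) d0 a0 ab b2; move: Km h; rewrite /K -/c.
move: (torus2_volume _) (density _) (m.+1%:R^-1) => V D i.
by rewrite mulrDl; lra.
Qed.

End volume_density.

(** * Characters and Bessel's inequality on the grid *)

Section bessel.
Context {R : realType}.

Lemma bessel (I Y : finType) (psi : I -> Y -> R[i]) (c : R) (g : Y -> R[i]) :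
  0 < c ->
  (forall i j, \sum_y psi i y * conjc (psi j y) = (c * (i == j)%:R)%:C%C) ->
  \sum_i normc (\sum_y g y * psi i y) ^+ 2 <= c * \sum_y normc (g y) ^+ 2.
Proof.
move=> c0 orth; pose a i := \sum_y g y * psi i y.
pose s y := \sum_i a i * conjc (psi i y).
(* c times the component of g orthogonal to the conjugates of the psi i. *)
pose w y := c%:C%C * g y - s y.
pose A := \sum_i normc (a i) ^+ 2; pose G := \sum_y normc (g y) ^+ 2.
have AE : A%:C%C = \sum_i a i * conjc (a i).
  by rewrite rmorph_sum; apply: eq_bigr => i _; exact: normc_sqr.
have GE : G%:C%C = \sum_y g y * conjc (g y).
  by rewrite rmorph_sum; apply: eq_bigr => i _; exact: normc_sqr.
have gs : \sum_y g y * conjc (s y) = A%:C%C.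
  rewrite AE; under eq_bigr do rewrite rmorph_sum mulr_sumr.
  rewrite exchange_big /=; apply: eq_bigr => i _.
  rewrite [a i in RHS]/a mulr_suml; apply: eq_bigr => y _.
  by rewrite rmorphM /= conjcK; ring.
have sg : \sum_y s y * conjc (g y) = A%:C%C.
  rewrite -(conjc_real A) -gs rmorph_sum; apply: eq_bigr => y _.
  by rewrite rmorphM /= conjcK mulrC.
have ss : \sum_y s y * conjc (s y) = (c * A)%:C%C.
  rewrite rmorphM /= AE mulr_sumr.
  transitivity (\sum_i \sum_j (a i * conjc (a j)) * \sum_y psi j y * conjc (psi i y)).
    under eq_bigr do rewrite rmorph_sum big_distrlr /=.
    rewrite exchange_big /=; apply: eq_bigr => i _.
    rewrite exchange_big /=; apply: eq_bigr => j _.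
    by rewrite mulr_sumr; apply: eq_bigr => y _; rewrite rmorphM /= conjcK; ring.
  apply: eq_bigr => i _; rewrite (bigD1 i)//= [X in _ + X]big1 => [|j ji].
    by rewrite orth eqxx mulr1 addr0 mulrC.
  by rewrite orth (negbTE ji) mulr0 mulr0.
have : 0 <= \sum_y normc (w y) ^+ 2 by apply: sumr_ge0 => y _; exact: sqr_ge0.
have -> : \sum_y normc (w y) ^+ 2 = c * (c * G - A).
  apply: complexI; rewrite rmorph_sum /=.
  transitivity (\sum_y (c%:C%C * c%:C%C * (g y * conjc (g y)) - c%:C%C * (g y * conjc (s y))
      - c%:C%C * (s y * conjc (g y)) + s y * conjc (s y))).
    apply: eq_bigr => y _; rewrite normc_sqr /w.
    have -> : conjc (c%:C%C * g y - s y) = c%:C%C * conjc (g y) - conjc (s y).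
      by rewrite (rmorphB conjc) (rmorphM conjc) /= oppr0.
    by ring.
  rewrite big_split sumrB sumrB /= -!mulr_sumr -GE gs sg ss.
  by rewrite !(rmorphM, rmorphB) /=; ring.
by rewrite pmulr_rge0// subr_ge0.
Qed.

End bessel.

Section characters.
Context {R : realType} {d n : nat}.
Local Notation freq := {ffun 'I_d -> 'I_n.+1}.
Implicit Types (k l : freq) (z w : 'rV[R]_d).

Lemma freq_neq k l : k != l -> exists i, k i != l i.
Proof.
move=> kl; apply/existsP; apply: contraR kl; rewrite negb_exists => /forallP kl.
by apply/eqP/ffunP => i; have := kl i; rewrite negbK => /eqP.
Qed.

Definition char k z : R[i] := \prod_i expi2pi (z 0 i) ^+ k i.

Lemma charD k z w : char k (z + w) = char k z * char k w.
Proof.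
rewrite /char -big_split /=; apply: eq_bigr => i _.
by rewrite mxE expi2piD exprMn.
Qed.

Lemma charN k z : char k (- z) = conjc (char k z).
Proof.
rewrite /char rmorph_prod; apply: eq_bigr => i _.
by rewrite mxE expi2piN rmorphXn.
Qed.

Lemma char_mul_conj k z : char k z * conjc (char k z) = 1.
Proof.
rewrite -normc_sqr (_ : normc _ = 1) ?expr1n//.
rewrite /char; elim/big_rec: _ => [|i x _ x1]; first exact: normc1.
by rewrite normcM x1 normcX normc_expi2pi expr1n mulr1.
Qed.

Lemma normc_char k z : normc (char k z) = 1.
Proof.
apply/eqP; rewrite -(@eqrXn2 _ 2) ?normc_ge0//; apply/eqP/complexI.
by rewrite normc_sqr char_mul_conj expr1n.
Qed.

Lemma char_gridD m k (y h : {ffun 'I_d -> 'I_m.+1}) :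
  char k (grid_pt (y + h)) = char k (grid_pt y) * char k (grid_pt h).
Proof.
rewrite -charD /char; apply: eq_bigr => i _; congr (_ ^+ _).
have [q ->] := grid_ptD (R := R) y h i.
by rewrite expi2piD expi2pi_int mulr1; congr expi2pi; rewrite [RHS]mxE.
Qed.

Lemma sum_char_line m (a b : 'I_n.+1) : (n <= m)%N ->
  \sum_(x < m.+1) expi2pi (x%:R / m.+1%:R : R) ^+ a * conjc (expi2pi (x%:R / m.+1%:R) ^+ b)
   = (m.+1%:R * (a == b)%:R)%:C%C.
Proof.
move=> nm.
have main (u v : nat) : (u < v <= m)%N ->
    \sum_(x < m.+1) expi2pi (x%:R / m.+1%:R : R) ^+ v * conjc (expi2pi (x%:R / m.+1%:R) ^+ u) = 0.
  move=> /andP[uv vm]; rewrite -[RHS](@sum_expi2pi_frac R (v - u) m.+1).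
    apply: eq_bigr => x _; set e := expi2pi _.
    have ee : e * conjc e = 1 by rewrite -normc_sqr normc_expi2pi expr1n.
    rewrite -[in LHS](subnK (ltnW uv)) exprD rmorphXn /= -mulrA -exprMn ee expr1n mulr1.
    rewrite /e -!expi2pi_mulrn; congr expi2pi.
    rewrite -[LHS]mulr_natr -[RHS]mulr_natr.
    move: (m.+1%:R^-1) (x%:R) ((v - u)%:R) => p q r.
    by rewrite mulrAC [RHS]mulrC mulrA [q * r]mulrC.
  by rewrite subn_gt0 uv ltnS (leq_trans (leq_subr _ _)).
case: eqVneq => [->|ab].
  rewrite mulr1 rmorph_nat (eq_bigr (fun=> 1)) => [|x _].
    by rewrite sumr_const card_ord.
  by rewrite -normc_sqr normcX normc_expi2pi !expr1n.
rewrite mulr0; have [lt_ba|lt_ab|/val_inj eab] := ltngtP b a; last by rewrite eab eqxx in ab.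
  by rewrite main// lt_ba (leq_trans _ nm)// -ltnS.
apply: (can_inj (@conjcK R)); rewrite conjc0 rmorph_sum -[RHS](main a b).
  by apply: eq_bigr => x _; rewrite rmorphM /= conjcK mulrC.
by rewrite lt_ab (leq_trans _ nm)// -ltnS.
Qed.

(** Frequencies below M stay distinct modulo M, so the sums over a line are
    geometric sums over nontrivial roots of unity. *)
Lemma char_orthogonal m k l : (n <= m)%N ->
  \sum_(y : {ffun 'I_d -> 'I_m.+1}) char k (grid_pt y) * conjc (char l (grid_pt y))
  = (m.+1%:R ^+ d * (k == l)%:R)%:C%C.
Proof.
move=> nm; pose f (i : 'I_d) (x : 'I_m.+1) : R[i] := 
  expi2pi (x%:R / m.+1%:R : R) ^+ k i * conjc (expi2pi (x%:R / m.+1%:R) ^+ l i).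
transitivity (\sum_(y : {ffun 'I_d -> 'I_m.+1}) \prod_i f i (y i)).
  apply: eq_bigr => y _; rewrite /char rmorph_prod -big_split /=.
  by apply: eq_bigr => i _; rewrite mxE.
rewrite -bigA_distr_bigA /=.
under eq_bigr do rewrite sum_char_line//.
case: eqVneq => [->|kl].
  rewrite mulr1 rmorphXn /= (eq_bigr (fun=> m.+1%:R%:C%C)) => [|i _].
    by rewrite prodr_const card_ord.
  by rewrite eqxx mulr1.
have [i ki] := freq_neq kl.
by rewrite (bigD1 i)//= (negbTE ki) mulr0 mul0r mulr0.
Qed.

End characters.

(** * Fourier coefficients of shells *)

Section harmonic.
Context {R : realType}.

Lemma harmonic_pow2 p : \sum_(1 <= i < 2 ^ p) (i%:R)^-1 <= p%:R :> R.
Proof.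
elim: p => [|p IH]; first by rewrite big_geq.
rewrite (@big_cat_nat _ _ _ (2 ^ p)) ?expn_gt0// ?leq_pexp2l//= -natr1.
apply: lerD => //.
apply: le_trans (_ : \sum_(2 ^ p <= i < 2 ^ p.+1) (2 ^ p)%:R^-1 <= _).
  rewrite big_nat_cond [leRHS]big_nat_cond; apply: ler_sum => i /andP[/andP[pi _] _].
  by rewrite lef_pV2 ?ler_nat// posrE ltr0n ?expn_gt0// (leq_trans _ pi)// expn_gt0.
rewrite sumr_const_nat expnS mul2n -addnn addnK -[leLHS]mulr_natr mulVf//.
Qed.

(** The term x = k vanishes, the inverse of zero being zero. *)
Lemma harmonic_ord n p (k : 'I_n.+1) : (n.+1 <= 2 ^ p)%N ->
  \sum_(x < n.+1) (`|x%:R - k%:R|)^-1 <= 2 * p%:R :> R.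
Proof.
move=> np; pose H := \sum_(1 <= i < 2 ^ p) (i%:R)^-1 : R.
have Hp : H <= p%:R := harmonic_pow2 p.
have part q : (q <= 2 ^ p)%N -> \sum_(1 <= i < q) (i%:R)^-1 <= H.
  case: q => [|q] qp; first by rewrite big_geq// sumr_ge0.
  by rewrite /H [leRHS](@big_cat_nat _ _ _ q.+1)//= lerDl sumr_ge0.
rewrite -(big_mkord xpredT (fun x => (`|x%:R - k%:R|)^-1)).
have kn : (k < n.+1)%N := ltn_ord k.
rewrite (@big_cat_nat _ _ _ k)//=; last exact: ltnW.
have -> : 2 * p%:R = p%:R + p%:R :> R by ring.
apply: lerD; apply: le_trans Hp.
  apply: le_trans (part k.+1 (leq_trans kn np)).
  rewrite big_add1 /= big_nat_rev /= add0n big_nat [leRHS]big_nat.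
  apply: ler_sum => i /andP[_ ik].
  by rewrite natrB// addrAC subrr add0r normrN ger0_norm.
rewrite -{1}[nat_of_ord k]add0n big_addn.
rewrite big_ltn ?subn_gt0// add0n subrr normr0 invr0 add0r.
apply: le_trans (part (n.+1 - k)%N (leq_trans (leq_subr _ _) np)).
by apply: ler_sum => i _; rewrite natrD addrK ger0_norm.
Qed.

End harmonic.

Section coefficients.
Context {R : realType} {d n m : nat}.
Local Notation freq := {ffun 'I_d -> 'I_n.+1}.
Local Notation grid := {ffun 'I_d -> 'I_m.+1}.
Local Notation M := m.+1.
Implicit Types (k l : freq) (y h : grid) (A : pred grid).

(** The Fourier coefficient of the indicator of A at the frequency k - l; keeping
    the pair (k, l) avoids negative frequencies. *)
Definition coef A k l : R[i] := (M%:R ^- d)%:C%C *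
  \sum_y ((A y)%:R)%:C%C * (char l (grid_pt y) * conjc (char k (grid_pt y))).

Lemma coef_conj A k l : conjc (coef A k l) = coef A l k.
Proof.
rewrite /coef (rmorphM conjc) /= oppr0 (rmorph_sum conjc); congr (_ * _).
by apply: eq_bigr => y _; rewrite !(rmorphM conjc) /= oppr0 conjcK [X in _ * X]mulrC.
Qed.

Lemma coef_diag A k : coef A k k = (density A)%:C%C.
Proof.
rewrite /coef /density natr_card mulrC [in RHS]mulrC -/(M%:R ^- d).
rewrite rmorphM /= [RHS]mulrC; congr (_ * _).
by rewrite rmorph_sum; apply: eq_bigr => y _; rewrite char_mul_conj mulr1.
Qed.

Lemma coef_shift A k l h :
  (conjc (char l (grid_pt h)) * char k (grid_pt h) - 1) * coef A k l =
  (M%:R ^- d)%:C%C * \sum_(y : grid) ((A (y + h))%:R - (A y)%:R)%:C%C *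
     (char l (grid_pt y) * conjc (char k (grid_pt y))).
Proof.
rewrite mulrBl mul1r /coef mulrCA -mulrBr; congr (_ * _).
under [RHS]eq_bigr do rewrite rmorphB mulrBl.
rewrite sumrB; congr (_ - _).
rewrite [in LHS](reindex_inj (@addIr grid h)) /= mulr_sumr; apply: eq_bigr => y _.
rewrite !char_gridD (rmorphM conjc) /=.
have hl := @char_mul_conj R d n l (grid_pt h); have hk := @char_mul_conj R d n k (grid_pt h).
set a := _%:C%C; move: (char l _) (char k _) (char l _) (char k _) hl hk a => p q r s hl hk a.
transitivity (a * (p * conjc q) * (r * conjc r) * (s * conjc s)).
  by ring.
by rewrite hl hk !mulr1.
Qed.

(** Translating A by h multiplies its Fourier coefficients by characters, so
    Bessel's inequality for the difference of the two indicators weighs each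
    coefficient by how far h moves the corresponding character from 1. *)
Lemma coef_bessel A k h : (n <= m)%N ->
  \sum_l normc (1 - conjc (char l (grid_pt h)) * char k (grid_pt h)) ^+ 2 * normc (coef A k l) ^+ 2
  <= density [pred y | A (y + h) != A y].
Proof.
move=> nm; pose g y := ((A (y + h))%:R - (A y)%:R)%:C%C * conjc (char k (grid_pt y)) : R[i].
have Md : 0 < M%:R ^+ d :> R := gridM_gt0.
have orth (i j : freq) := @char_orthogonal R d n m i j nm.
have := bessel g Md orth.
have -> : \sum_y normc (g y) ^+ 2 = #|[pred y | A (y + h) != A y]|%:R.
  rewrite natr_card; apply: eq_bigr => y _ /=.
  rewrite normcM normc_conj normc_char mulr1 normc_real.
  by case: (A (y + h)); case: (A y);
    rewrite /= ?subrr ?subr0 ?sub0r ?normrN ?normr0 ?normr1 ?expr0n ?expr1n.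
move=> B; rewrite /density -(ler_pM2l (exprn_gt0 2 Md)).
rewrite mulr_sumr.
apply: le_trans (_ : _ <= M%:R ^+ d * #|[pred y | A (y + h) != A y]|%:R) _; last first.
  move: (M%:R ^+ d) (#|_|%:R) Md => c N c0.
  by have -> : c ^+ 2 * (N / c) = c * N by field; rewrite gt_eqF.
apply: le_trans B; apply: ler_sum => l _.
rewrite normc_subC -!exprMn -normcM coef_shift normcM normc_real ger0_norm; last first.
  by rewrite invr_ge0 ltW.
rewrite mulrA divff ?gt_eqF// mul1r; rewrite le_eqVlt; apply/orP; left; apply/eqP.
by congr (normc _ ^+ 2); apply: eq_bigr => y _; rewrite /g; ring.
Qed.

End coefficients.

Section coefficient_sum.
Context {R : realType} {d n m p : nat}.
Local Notation freq := {ffun 'I_d -> 'I_n.+1}.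
Local Notation grid := {ffun 'I_d -> 'I_m.+1}.
Local Notation M := m.+1.
Implicit Types (k l : freq) (y h : grid) (j : 'I_d).

Lemma char_axis l j (t : 'I_M) :
  char l (grid_pt (axis j t)) = expi2pi (t%:R / M%:R : R) ^+ l j.
Proof.
rewrite /char (bigD1 j)//= big1 => [|i ij].
  by rewrite mulr1 mxE ffunE eqxx.
by rewrite mxE ffunE (negbTE ij) mul0r expi2pi0 expr1n.
Qed.

(** For the dyadic scale with 1/4 <= |a - b| / 2^i <= 1/2, the factor on the right
    is at least 2 by [normc1B_expi2pi_far]; all other scales contribute
    nonnegative terms. *)
Lemma dyadic_weight (a b : nat) : (a < 2 ^ p)%N -> (b < 2 ^ p)%N ->
  `|a%:R - b%:R| <= 1 / 4 * \sum_(i < p.+1) 2 ^+ i.+1 *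
    normc (1 - expi2pi ((a%:R - b%:R) / 2 ^+ i.+1)) ^+ 2 :> R.
Proof.
move=> ap bp; set u := a%:R - b%:R.
have term_ge0 (i : nat) : 0 <= 2 ^+ i.+1 * normc (1 - expi2pi (u / 2 ^+ i.+1)) ^+ 2 :> R.
  by rewrite mulr_ge0 ?exprn_ge0 ?normc_ge0.
have [x ux xp] : exists2 x : nat, `|u| = x%:R & (x < 2 ^ p)%N.
  rewrite /u; have [ab|/ltnW ba] := leqP a b.
    exists (b - a)%N; last exact: leq_ltn_trans (leq_subr _ _) bp.
    by rewrite natrB// distrC ger0_norm// subr_ge0 ler_nat.
  exists (a - b)%N; last exact: leq_ltn_trans (leq_subr _ _) ap.
  by rewrite natrB// ger0_norm// subr_ge0 ler_nat.
have [x0|x0] := posnP x.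
  by rewrite ux x0 mulr_ge0// sumr_ge0.
have x4 : (0 < 4 * x)%N by rewrite muln_gt0.
have /andP[i1 i2] := trunc_log_bounds (isT : (1 < 2)%N) x4.
set i0 := trunc_log 2 (4 * x) in i1 i2.
have i0p : (i0 <= p.+1)%N.
  rewrite -ltnS -(@ltn_exp2l 2)//; apply: leq_ltn_trans i1 _.
  by rewrite !expnS; lia.
have i00 : (0 < i0)%N.
  rewrite lt0n; apply/eqP => i00; move: i2; rewrite i00 expn1; lia.
have ii : (i0.-1 < p.+1)%N by rewrite prednK.
rewrite (bigD1 (Ordinal ii))//= prednK//.
have two0 : 0 < 2 ^+ i0 :> R by rewrite exprn_gt0.
have i1' : 2 ^+ i0 <= 4 * `|u| by rewrite ux -natrX -natrM ler_nat.
have i2' : 4 * `|u| < 2 * 2 ^+ i0 by rewrite ux -exprS -natrX -natrM ltr_nat.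
have far : 2 <= normc (1 - expi2pi (u / 2 ^+ i0)) ^+ 2.
  apply: normc1B_expi2pi_far; rewrite normrM normfV (ger0_norm (ltW two0)).
  by apply/andP; split; [rewrite ler_pdivlMr// | rewrite ler_pdivrMr//]; lra.
have rest : 0 <= \sum_(i < p.+1 | i != Ordinal ii) 2 ^+ i.+1 *
    normc (1 - expi2pi (u / 2 ^+ i.+1)) ^+ 2 :> R by exact: sumr_ge0.
by move: (\sum_(i < p.+1 | _) _) (normc _ ^+ 2) rest far => r s r0 s2; nra.
Qed.

Hypotheses (d0 : (0 < d)%N) (np : (n.+1 <= 2 ^ p)%N) (pM : (2 ^ p.+1 %| M)%N).

(** [coef_bessel] for the translation along the axis j by 2^-(i+1), which is a whole
    number of grid steps. *)
Lemma sum_coef_difference a b k j (i : 'I_p.+1) :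
  \sum_(l : freq) normc (1 - expi2pi (((k j)%:R - (l j)%:R) / 2 ^+ i.+1)) ^+ 2 *
         normc (coef (@shell R d m a b) k l) ^+ 2 <= 24 * d%:R ^+ 2 / 2 ^+ i.+1 :> R.
Proof.
have two_gt1 : (1 < 2 ^ i.+1)%N by rewrite -[1%N](expn0 2) ltn_exp2l.
have dvd2 : (2 ^ i.+1 %| M)%N by apply: dvdn_trans pM; rewrite dvdn_exp2l// ltn_ord.
have nm : (n <= m)%N.
  rewrite -ltnS; apply: leq_trans np _; apply: leq_trans (dvdn_leq _ pM) => //.
  by rewrite leq_exp2l.
have tM : (M %/ 2 ^ i.+1 < M)%N by rewrite ltn_Pdiv.
pose t : 'I_M := Ordinal tM; pose h : grid := axis j t.
have two0 : 0 < 2 ^+ i.+1 :> R by rewrite exprn_gt0.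
have tE : t%:R / M%:R = (2 ^+ i.+1)^-1 :> R.
  apply: (mulIf (lt0r_neq0 two0)); rewrite mulVf ?lt0r_neq0// mulrAC -natrX -natrM /=.
  by rewrite divnK// divff// pnatr_eq0.
have hw : \sum_i0 distZ (grid_pt h 0 i0 : R) <= (2 ^+ i.+1)^-1.
  rewrite (bigD1 j)//= big1 => [|i0 ij].
    rewrite addr0 -tE; apply: le_trans (distZ_le_norm _) _.
    by rewrite mxE ffunE eqxx ger0_norm.
  rewrite mxE ffunE (negbTE ij) mul0r; apply/eqP; rewrite eq_le distZ_ge0 andbT.
  by apply: le_trans (distZ_le_norm _) _; rewrite normr0.
have w0 : 0 <= (2 ^+ i.+1)^-1 :> R by rewrite invr_ge0 ltW.
have := le_trans (coef_bessel (@shell R d m a b) k h nm) (density_boundary a b d0 w0 hw).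
have Mw : M%:R^-1 <= (2 ^+ i.+1)^-1 :> R.
  by rewrite lef_pV2 ?posrE ?ltr0n// -natrX ler_nat dvdn_leq.
move=> B; apply: le_trans (le_trans B _).
  rewrite le_eqVlt; apply/orP; left; apply/eqP; apply: eq_bigr => l _.
  congr (normc (1 - _) ^+ 2 * _); rewrite !char_axis tE.
  rewrite -!expi2pi_mulrn -expi2piN -expi2piD; congr expi2pi.
  rewrite -!(mulr_natr (2 ^- i.+1)).
  by move: (2 ^+ i.+1)^-1 (l j)%:R (k j)%:R => x y z; ring.
move: Mw; move: (2 ^+ i.+1)^-1 (M%:R^-1) => x y yx.
have : 0 <= d%:R ^+ 2 * (x - y) :> R by rewrite mulr_ge0 ?sqr_ge0// subr_ge0.
by lra.
Qed.

(** Summing the previous bound over all dyadic scales: indicators of shells have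
    half a derivative in L2, up to a logarithm. *)
Lemma sum_coef_weight a b k j :
  \sum_(l : freq) `|(k j)%:R - (l j)%:R| * normc (coef (@shell R d m a b) k l) ^+ 2
    <= 6 * d%:R ^+ 2 * p.+1%:R :> R.
Proof.
apply: (@le_trans _ _ (\sum_(l : freq) 1 / 4 * \sum_(i < p.+1) 2 ^+ i.+1 *
   (normc (1 - expi2pi (((k j)%:R - (l j)%:R) / 2 ^+ i.+1)) ^+ 2 *
     normc (coef (@shell R d m a b) k l) ^+ 2))).
  apply: ler_sum => l _; under eq_bigr do rewrite mulrA.
  rewrite -mulr_suml [leRHS]mulrA ler_wpM2r ?sqr_ge0//.
  by apply: dyadic_weight; exact: leq_trans (ltn_ord _) np.
rewrite -mulr_sumr exchange_big /=.
apply: (@le_trans _ _ (1 / 4 * \sum_(i < p.+1) 24 * d%:R ^+ 2)).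
  rewrite ler_wpM2l//; apply: ler_sum => i _; rewrite -mulr_sumr mulrC.
  by rewrite -ler_pdivlMr ?exprn_gt0// sum_coef_difference.
by rewrite sumr_const card_ord -[_ *+ _]mulr_natr; lra.
Qed.

Definition weight k l : R := \sum_j `|(k j)%:R - (l j)%:R|.

Lemma weight_gt0 k l : l != k -> 0 < weight k l.
Proof.
move=> lk; have [j lj] := freq_neq lk.
rewrite /weight (bigD1 j)//=; apply: ltr_pwDl; last exact: sumr_ge0.
by rewrite normr_gt0 subr_eq0 eqr_nat eq_sym.
Qed.

Lemma weightV_le k l : l != k -> (weight k l)^-1 <= \sum_j (`|(k j)%:R - (l j)%:R|)^-1.
Proof.
move=> lk; have [j lj] := freq_neq lk.
have kl0 : 0 < `|(k j)%:R - (l j)%:R| :> R.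
  by rewrite normr_gt0 subr_eq0 eqr_nat eq_sym.
apply: (@le_trans _ _ (`|(k j)%:R - (l j)%:R|)^-1).
  rewrite lef_pV2 ?posrE ?weight_gt0//.
  by rewrite /weight (bigD1 j)//= lerDl sumr_ge0.
by rewrite (bigD1 j)//= lerDl sumr_ge0// => i _; rewrite invr_ge0.
Qed.

Lemma sum_weightV k : \sum_(l | l != k) (weight k l)^-1 <=
  2 * d%:R * p%:R * n.+1%:R ^+ d.-1.
Proof.
apply: (@le_trans _ _ (\sum_(l : freq) \sum_j (`|(k j)%:R - (l j)%:R|)^-1)).
  rewrite big_mkcond /=; apply: ler_sum => l _; case: ifP => [lk|_].
    exact: weightV_le.
  by apply: sumr_ge0 => j _; rewrite invr_ge0.
rewrite exchange_big /=.
apply: (@le_trans _ _ (\sum_(j < d) 2 * p%:R * n.+1%:R ^+ d.-1)).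
  apply: ler_sum => j _.
  have n0 : 0 < n.+1%:R :> R by rewrite ltr0n.
  rewrite -(ler_pM2l n0).
  rewrite (sum_coordinate (fun x => (`|(k j)%:R - x%:R|)^-1)).
  rewrite mulrCA -exprS prednK// mulrC ler_wpM2r ?exprn_ge0//.
  under eq_bigr do rewrite distrC.
  exact: harmonic_ord.
by rewrite sumr_const card_ord -[_ *+ _]mulr_natr; lra.
Qed.

(** Cauchy-Schwarz with the weight |k - l|: the first factor is controlled by
    [sum_coef_weight], the second by [sum_weightV]. The exponent (d - 1) / 2 of
    the number n of frequencies per axis is the one that the pointwise decay
    |k|^(-(d + 1) / 2) of the coefficients gives by summation over |k| <= n. *)
Lemma sum_coef_le a b k :
  (\sum_(l | l != k) normc (coef (@shell R d m a b) k l)) ^+ 2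
    <= 12 * d%:R ^+ 4 * p.+1%:R ^+ 2 * n.+1%:R ^+ d.-1 :> R.
Proof.
pose c l := normc (coef (@shell R d m a b) k l) : R.
have -> : \sum_(l | l != k) c l =
   \sum_(l : freq) (c l * Num.sqrt (weight k l)) *
     (if l != k then (Num.sqrt (weight k l))^-1 else 0).
  rewrite big_mkcond /=; apply: eq_bigr => l _; case: ifP => lk; last by rewrite mulr0.
  by rewrite mulfK// gt_eqF// sqrtr_gt0 weight_gt0.
apply: le_trans (cauchy_schwarz _ _) _.
have w0 l : 0 <= weight k l by apply: sumr_ge0.
have h1 : \sum_(l : freq) (c l * Num.sqrt (weight k l)) ^+ 2 <= 6 * d%:R ^+ 3 * p.+1%:R.
  apply: (@le_trans _ _ (\sum_(j < d) 6 * d%:R ^+ 2 * p.+1%:R)).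
    under eq_bigr do rewrite exprMn sqr_sqrtr// mulrC mulr_suml.
    by rewrite exchange_big /=; apply: ler_sum => j _; exact: sum_coef_weight.
  by rewrite sumr_const card_ord -[_ *+ _]mulr_natr; lra.
have h2 : \sum_(l : freq) (if l != k then (Num.sqrt (weight k l))^-1 else 0) ^+ 2 <=
   2 * d%:R * p.+1%:R * n.+1%:R ^+ d.-1.
  apply: le_trans (_ : 2 * d%:R * p%:R * n.+1%:R ^+ d.-1 <= _).
    apply: le_trans (sum_weightV k); rewrite [leRHS]big_mkcond /=.
    apply: ler_sum => l _; case: ifP => _; last by rewrite expr0n.
    by rewrite exprVn sqr_sqrtr.
  by rewrite ler_wpM2r ?exprn_ge0// ler_wpM2l ?mulr_ge0// ler_nat.
apply: (@le_trans _ _ ((6 * d%:R ^+ 3 * p.+1%:R) * (2 * d%:R * p.+1%:R * n.+1%:R ^+ d.-1))).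
  by apply: ler_pM => //; apply: sumr_ge0 => l _; exact: sqr_ge0.
by rewrite le_eqVlt; apply/orP; left; apply/eqP; ring.
Qed.

End coefficient_sum.

(** * Smoothing by a nonnegative trigonometric polynomial *)

Section kernels.
Context {R : realType} {d n m : nat}.
Local Notation freq := {ffun 'I_d -> 'I_n.+1}.
Local Notation grid := {ffun 'I_d -> 'I_m.+1}.
Local Notation M := m.+1.
Implicit Types (k l : freq) (y h : grid) (A : pred grid) (z : 'rV[R]_d) (t : R).
Variable c : 'I_n.+1 -> R.

Definition trigpoly t : R[i] := \sum_i (c i)%:C%C * expi2pi t ^+ i.

Definition coef_sqr : R := \sum_i c i ^+ 2.

(** Being a squared modulus, it is nonnegative; it is normalized to have mean one. *)
Definition line_kernel t : R := normc (trigpoly t) ^+ 2 / coef_sqr.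

Definition torus_kernel z : R := \prod_i line_kernel (z 0 i).

(** The convolution of the indicator of A with the kernel, with a grid average in
    place of the integral. As the kernel has at most M frequencies per axis, it
    still averages to one ([smooth1]). *)
Definition smooth A z : R := M%:R ^- d * \sum_y (A y)%:R * torus_kernel (z - grid_pt y).

Definition freq_coef k : R := \prod_i c (k i).

Hypotheses (c2 : 0 < coef_sqr) (nm : (n <= m)%N).

Lemma line_kernel_ge0 t : 0 <= line_kernel t.
Proof. by rewrite divr_ge0 ?sqr_ge0// ltW. Qed.

Lemma torus_kernel_ge0 z : 0 <= torus_kernel z.
Proof. by apply: prodr_ge0 => i _; exact: line_kernel_ge0. Qed.

Lemma sum_line_kernel t : \sum_(x < M) line_kernel (t - x%:R / M%:R) = M%:R.
Proof.
rewrite -mulr_suml; apply: (mulIf (lt0r_neq0 c2)); rewrite divfK ?lt0r_neq0//.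
apply: complexI; rewrite rmorph_sum /=.
pose e (x : 'I_M) : R[i] := expi2pi (x%:R / M%:R : R); pose f := expi2pi t.
have ff : f * conjc f = 1 by rewrite -normc_sqr normc_expi2pi expr1n.
transitivity (\sum_(x < M) \sum_i \sum_j ((c i)%:C%C * f ^+ i * ((c j)%:C%C * conjc f ^+ j)) *
    (e x ^+ j * conjc (e x ^+ i))).
  apply: eq_bigr => x _; rewrite normc_sqr /trigpoly (rmorph_sum conjc) big_distrlr /=.
  apply: eq_bigr => i _; apply: eq_bigr => j _.
  have gE : expi2pi (t - x%:R / M%:R) = f * conjc (e x) by rewrite expi2piD expi2piN.
  have gcE : conjc (expi2pi (t - x%:R / M%:R)) = conjc f * e x.
    by rewrite gE conjcM conjcK.
  rewrite conjcM conjcX conjc_real gcE gE conjcX !exprMn.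
  by move: (c i)%:C%C (c j)%:C%C (f ^+ i) (conjc f ^+ j) (e x ^+ j) (conjc (e x) ^+ i) => *; ring.
rewrite exchange_big /=.
transitivity (\sum_i M%:R * (c i ^+ 2)%:C%C : R[i]).
  apply: eq_bigr => i _; rewrite exchange_big /= (bigD1 i)//= [X in _ + X]big1 => [|j ji].
    rewrite -mulr_sumr sum_char_line// eqxx mulr1 addr0 mulrACA -exprMn ff expr1n mulr1.
    by rewrite rmorph_nat mulrC expr2 rmorphM.
  by rewrite -mulr_sumr sum_char_line// (negbTE ji) mulr0 mulr0.
by rewrite -mulr_sumr /coef_sqr rmorphM rmorph_nat rmorph_sum.
Qed.

Lemma sum_torus_kernel (G : 'I_d -> 'I_M -> R) z :
  \sum_(y : grid) \prod_i (G i (y i) * line_kernel (z 0 i - (y i)%:R / M%:R)) =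
  \prod_i \sum_x G i x * line_kernel (z 0 i - x%:R / M%:R).
Proof. by rewrite -(bigA_distr_bigA (fun i x => G i x * line_kernel (z 0 i - x%:R / M%:R))). Qed.

Lemma torus_kernelE z y : torus_kernel (z - grid_pt y) = \prod_i line_kernel (z 0 i - (y i)%:R / M%:R).
Proof. by apply: eq_bigr => i _; rewrite !mxE. Qed.

Lemma smooth1 z : smooth predT z = 1.
Proof.
rewrite /smooth (eq_bigr (fun y => \prod_i (1 * line_kernel (z 0 i - (y i)%:R / M%:R)))) => [|y _].
  rewrite (sum_torus_kernel (fun _ _ => 1)); under eq_bigr do under eq_bigr do rewrite mul1r.
  under eq_bigr do rewrite sum_line_kernel.
  by rewrite prodr_const card_ord mulVf// gt_eqF// gridM_gt0.
by rewrite /= mul1r torus_kernelE; under [RHS]eq_bigr do rewrite mul1r.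
Qed.

Lemma smooth_sub A (B : pred grid) z : (forall y, A y -> B y) -> smooth A z <= smooth B z.
Proof.
move=> AB; rewrite ler_pM2l ?invr_gt0 ?gridM_gt0//; apply: ler_sum => y _.
apply: ler_wpM2r; first exact: torus_kernel_ge0.
by have := AB y; case: (A y) => [->|_]//; case: (B y).
Qed.

Lemma smoothU A (B : pred grid) z : smooth [pred y | A y || B y] z <= smooth A z + smooth B z.
Proof.
rewrite -mulrDr ler_pM2l ?invr_gt0 ?gridM_gt0// -big_split /=; apply: ler_sum => y _.
rewrite -mulrDl; apply: ler_wpM2r; first exact: torus_kernel_ge0.
by case: (A y); case: (B y) => //=; rewrite ?addr0 ?add0r ?lerDl.
Qed.

Lemma smooth_ge0 A z : 0 <= smooth A z.
Proof.
rewrite mulr_ge0 ?invr_ge0 ?(ltW (gridM_gt0 (R := R) (d := d) (m := m)))// sumr_ge0// => y _.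
by rewrite mulr_ge0 ?torus_kernel_ge0.
Qed.

Variables (delta eta : R).
Hypothesis tail1 : forall t, delta < distZ t -> line_kernel t <= eta.

Lemma smooth_far_coordinate z (j : 'I_d) : 0 <= eta ->
  smooth [pred y : grid | delta < distZ (z 0 j - (y j)%:R / M%:R)] z <= eta.
Proof.
move=> eta0.
pose G i (x : 'I_M) := (if i == j then (delta < distZ (z 0 j - x%:R / M%:R))%R%:R else 1) : R.
rewrite /smooth (eq_bigr (fun y => \prod_i
    (G i (y i) * line_kernel (z 0 i - (y i)%:R / M%:R)))) => [|y _]; last first.
  rewrite torus_kernelE (bigD1 j)//= [RHS](bigD1 j)//= /G eqxx mulrA; congr (_ * _).
  by apply: eq_bigr => i ij; rewrite (negbTE ij) mul1r.
rewrite sum_torus_kernel (bigD1 j)//=.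
have rest : \prod_(i < d | i != j) (\sum_x G i x * line_kernel (z 0 i - x%:R / M%:R)) =
    \prod_(i < d | i != j) M%:R.
  apply: eq_bigr => i ij; rewrite -[RHS](sum_line_kernel (z 0 i)).
  by apply: eq_bigr => x _; rewrite /G (negbTE ij) mul1r.
rewrite rest.
rewrite mulrC ler_pdivrMr ?gridM_gt0//.
apply: (@le_trans _ _ ((eta * M%:R) * \prod_(i | i != j) M%:R)).
  apply: ler_wpM2r; first exact: prodr_ge0.
  apply: (@le_trans _ _ (\sum_(x < M) eta)); last by rewrite sumr_const card_ord mulr_natr.
  apply: ler_sum => x _; rewrite /G eqxx; case: (boolP (_ < _)) => [/tail1|_] /=.
    by rewrite mul1r.
  by rewrite mul0r.
rewrite -mulrA le_eqVlt; apply/orP; left; apply/eqP; congr (_ * _).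
by rewrite -[d in RHS]card_ord -prodr_const [RHS](bigD1 j).
Qed.

Definition far z : pred grid :=
  [pred y : grid | [exists j, delta < distZ (z 0 j - (y j)%:R / M%:R)]].

(** The total mass of the kernel at points where some coordinate is farther than
    delta from the integers: by the product structure each coordinate contributes
    the one-dimensional tail. *)
Lemma smooth_far z : 0 <= eta -> smooth (far z) z <= d%:R * eta.
Proof.
move=> eta0; apply: (@le_trans _ _ (\sum_(j < d)
   smooth [pred y : grid | delta < distZ (z 0 j - (y j)%:R / M%:R)] z)).
  rewrite /smooth -mulr_sumr exchange_big /= ler_pM2l ?invr_gt0 ?gridM_gt0//.
  apply: ler_sum => y _; rewrite -mulr_suml; apply: ler_wpM2r; first exact: torus_kernel_ge0.
  case: (boolP (far z y)) => [/existsP[j yj]|_]; last exact: sumr_ge0.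
  by rewrite (bigD1 j)//= yj lerDl sumr_ge0.
apply: (@le_trans _ _ (\sum_(j < d) eta)); last by rewrite sumr_const card_ord mulr_natl.
by apply: ler_sum => j _; exact: smooth_far_coordinate.
Qed.

Lemma near_dist z y : ~~ far z y ->
  `|tnorm z - dist_norm y| <= d%:R * delta.
Proof.
rewrite negb_exists => /forallP near.
apply: le_trans (tnorm_lipschitz _ _) _.
apply: (@le_trans _ _ (\sum_(j < d) delta)); last by rewrite sumr_const card_ord mulr_natl.
by apply: ler_sum => j _; have := near j; rewrite -leNgt mxE.
Qed.

(** Enlarging the shell by the width of the kernel makes its smoothing equal to one
    on the original shell, up to the tail of the kernel. *)
Lemma smooth_majorant a b z : 0 <= eta ->
  (a <= tnorm z <= b)%R%:R <=
    smooth (shell (a - d%:R * delta) (b + d%:R * delta)) z + d%:R * eta.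
Proof.
move=> eta0; set w := d%:R * delta; have far0 := smooth_far z eta0.
case: (boolP (a <= tnorm z <= b)) => [/andP[az zb]|_]; last first.
  by rewrite addr_ge0 ?smooth_ge0 ?mulr_ge0.
apply: (@le_trans _ _ (smooth predT z)); first by rewrite smooth1.
apply: le_trans (lerD (lexx _) far0); apply: le_trans (smoothU _ _ _).
apply: smooth_sub => y _ /=; rewrite orbC -implyNb; apply/implyP => /near_dist.
rewrite -/w ler_norml => /andP[? ?]; apply/andP; split; lra.
Qed.

Lemma smooth_minorant a b z : 0 <= eta ->
  smooth (shell (a + d%:R * delta) (b - d%:R * delta)) z <=
    (a <= tnorm z <= b)%R%:R + d%:R * eta.
Proof.
move=> eta0; set w := d%:R * delta; have far0 := smooth_far z eta0.
have deta0 : 0 <= d%:R * eta by rewrite mulr_ge0.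
case: (boolP (a <= tnorm z <= b)) => [zab|zab] /=.
  by apply: (@le_trans _ _ (smooth predT z)); [exact: smooth_sub|rewrite smooth1 lerDl].
rewrite add0r; apply: le_trans far0; apply: smooth_sub => y /andP[ya yb].
apply: contraR zab => /near_dist; rewrite -/w ler_norml => /andP[? ?].
by apply/andP; split; lra.
Qed.

End kernels.

(** * Counting pairs by Fourier expansion *)

Section off_diagonal.
Context {R : realType} {d n m : nat}.
Local Notation freq := {ffun 'I_d -> 'I_n.+1}.
Local Notation grid := {ffun 'I_d -> 'I_m.+1}.
Local Notation M := m.+1.
Implicit Types (k l : freq) (y : grid) (A : pred grid) (z : 'rV[R]_d).
Variable c : 'I_n.+1 -> R.
Hypotheses (c0 : forall i, 0 <= c i) (c2 : 0 < coef_sqr c).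
Local Notation q := (freq_coef c).

Lemma trigpoly_prod z :
  \prod_i trigpoly c (z 0 i) = \sum_(k : freq) (q k)%:C%C * char k z.
Proof.
rewrite /trigpoly bigA_distr_bigA /=; apply: eq_bigr => k _.
by rewrite big_split /= rmorph_prod.
Qed.

Lemma sum_freq_coef_sqr : \sum_(k : freq) q k ^+ 2 = coef_sqr c ^+ d.
Proof.
rewrite -[d in RHS]card_ord -prodr_const /coef_sqr bigA_distr_bigA /=.
by apply: eq_bigr => k _; rewrite /freq_coef prodrXl.
Qed.

Lemma freq_coef_ge0 k : 0 <= q k.
Proof. by apply: prodr_ge0. Qed.

Lemma torus_kernel_expand z : (coef_sqr c ^+ d * torus_kernel c z)%:C%C =
  \sum_(k : freq) \sum_(l : freq) (q k * q l)%:C%C * (char k z * conjc (char l z)).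
Proof.
have -> : coef_sqr c ^+ d * torus_kernel c z = normc (\prod_i trigpoly c (z 0 i)) ^+ 2.
  have -> : coef_sqr c ^+ d = \prod_(i < d) coef_sqr c by rewrite prodr_const card_ord.
  rewrite /torus_kernel -big_split /=.
  rewrite (_ : normc (\prod_i trigpoly c (z 0 i)) = \prod_i normc (trigpoly c (z 0 i))).
    by rewrite -prodrXl; apply: eq_bigr => i _; rewrite /line_kernel mulrC divfK// gt_eqF.
  by elim/big_rec2: _ => [|i x y _ <-]; rewrite ?normc1 ?normcM.
rewrite normc_sqr trigpoly_prod (rmorph_sum conjc) big_distrlr /=.
apply: eq_bigr => k _; apply: eq_bigr => l _.
by rewrite conjcM conjc_real rmorphM mulrACA.
Qed.

Lemma smooth_expand A z : (coef_sqr c ^+ d * smooth c A z)%:C%C =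
  \sum_(k : freq) \sum_(l : freq)
    (q k * q l)%:C%C * (char k z * conjc (char l z)) * coef A k l.
Proof.
rewrite /smooth mulrCA mulr_sumr rmorphM rmorph_sum /=.
transitivity (((M%:R ^+ d)^-1)%:C%C * \sum_(y : grid) \sum_(k : freq) \sum_(l : freq)
   (q k * q l)%:C%C * (char k z * conjc (char l z)) *
     (((A y)%:R)%:C%C * (char l (grid_pt y) * conjc (char k (grid_pt y))))).
  congr (_ * _); apply: eq_bigr => y _.
  rewrite mulrCA rmorphM /= torus_kernel_expand mulr_sumr; apply: eq_bigr => k _.
  rewrite mulr_sumr; apply: eq_bigr => l _.
  rewrite !charD !charN conjcM conjcK.
  move: (q k * q l)%:C%C ((A y)%:R)%:C%C (char k z) (conjc (char k _)).
  move: (conjc (char l z)) (char l _) => x1 x2 x3 x4 x5 x6.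
  by ring.
rewrite [in LHS]exchange_big /= mulr_sumr; apply: eq_bigr => k _.
rewrite [in LHS]exchange_big /= mulr_sumr; apply: eq_bigr => l _.
by rewrite /coef [RHS]mulrCA [in RHS]mulr_sumr.
Qed.

Context {I : finType}.
Variable u : I -> 'rV[R]_d.

Definition expsum k l : R[i] := \sum_i char k (u i) * conjc (char l (u i)).

Lemma sum_smooth_expand A :
  (coef_sqr c ^+ d * \sum_i \sum_j smooth c A (u i - u j))%:C%C =
  \sum_(k : freq) \sum_(l : freq)
    (q k * q l * normc (expsum k l) ^+ 2)%:C%C * coef A k l.
Proof.
rewrite mulr_sumr rmorph_sum /=.
transitivity (\sum_i \sum_j \sum_(k : freq) \sum_(l : freq)
    (q k * q l)%:C%C * (char k (u i - u j) * conjc (char l (u i - u j))) * coef A k l).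
  apply: eq_bigr => i _; rewrite mulr_sumr rmorph_sum; apply: eq_bigr => j _.
  exact: smooth_expand.
under [LHS]eq_bigr do rewrite exchange_big /=.
rewrite [LHS]exchange_big /=; apply: eq_bigr => k _.
under [LHS]eq_bigr do rewrite exchange_big /=.
rewrite [LHS]exchange_big /=; apply: eq_bigr => l _.
rewrite [in RHS]rmorphM /= normc_sqr /expsum (rmorph_sum conjc) big_distrlr /=.
rewrite mulr_sumr mulr_suml; apply: eq_bigr => i _.
rewrite mulr_sumr mulr_suml; apply: eq_bigr => j _.
rewrite !charD !charN !conjcM !conjcK; congr (_ * _ * _).
by ring.
Qed.

Variables (B T : R).
Hypothesis (expsum_le : forall k l, l != k -> normc (expsum k l) ^+ 2 <= B).

(** The diagonal k = l gives the main term. Off the diagonal, the products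
    q k * q l are bounded by half the sum of their squares; the resulting double
    sum is a Schur test with row sums at most T. *)
Lemma sum_smooth_diag A :
  (forall k, \sum_(l | l != k) normc (coef A k l) <= T) -> 0 <= B ->
  `|\sum_i \sum_j smooth c A (u i - u j) - #|I|%:R ^+ 2 * density A| <= B * T.
Proof.
move=> coefT B0; set S := \sum_i _.
have C0 : 0 < coef_sqr c ^+ d by rewrite exprn_gt0.
have coefC k l : normc (coef A k l) = normc (coef A l k) :> R.
  by rewrite -coef_conj normc_conj.
have expsum1 k : expsum k k = #|I|%:R :> R[i].
  by rewrite /expsum (eq_bigr (fun=> 1)) => [|i _]; rewrite ?sumr_const ?char_mul_conj.
have eqC : (coef_sqr c ^+ d * (S - #|I|%:R ^+ 2 * density A))%:C%C =
    \sum_(k : freq) \sum_(l | l != k)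
      (q k * q l * normc (expsum k l) ^+ 2)%:C%C * coef A k l.
  rewrite mulrBr rmorphB /= /S sum_smooth_expand.
  apply/eqP; rewrite subr_eq; apply/eqP.
  rewrite -sum_freq_coef_sqr mulr_suml rmorph_sum -big_split /=.
  apply: eq_bigr => k _; rewrite (bigD1 k)//= addrC; congr (_ + _).
  rewrite coef_diag expsum1 -rmorphM /=; congr (_ %:C)%C.
  rewrite (_ : normc #|I|%:R = #|I|%:R) ?expr2 ?mulrA//.
  by rewrite -(rmorph_nat (real_complex R)) -[RHS]ger0_norm ?ler0n //; exact: normc_real.
rewrite -(ler_pM2l C0) -[X in X * `|_|](ger0_norm (ltW C0)) -normrM.
rewrite -normc_real eqC.
apply: le_trans (normc_sum _ _ _) _.
apply: (@le_trans _ _ (\sum_(k : freq) \sum_(l | l != k)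
   B * (1 / 2 * (q k ^+ 2 * normc (coef A k l)) + 1 / 2 * (q l ^+ 2 * normc (coef A l k))))).
  apply: ler_sum => k _; apply: le_trans (normc_sum _ _ _) _.
  apply: ler_sum => l lk; rewrite normcM normc_real ger0_norm; last first.
    by rewrite !mulr_ge0 ?freq_coef_ge0 ?sqr_ge0 ?normc_ge0.
  rewrite (coefC l k).
  have := expsum_le lk; have := @normc_ge0 R (coef A k l).
  have := freq_coef_ge0 k; have := freq_coef_ge0 l.
  move: (q k) (q l) (normc (coef A k l)) (normc (expsum k l) ^+ 2) => x y w e y0 x0 w0 eB.
  apply: (@le_trans _ _ (x * y * B * w)).
    by apply: ler_wpM2r => //; apply: ler_wpM2l => //; exact: mulr_ge0.
  have : 0 <= B * w * (x - y) ^+ 2 by rewrite mulr_ge0 ?sqr_ge0// mulr_ge0.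
  by rewrite sqrrB; lra.
have half : \sum_(k : freq) \sum_(l | l != k) q k ^+ 2 * normc (coef A k l) <= coef_sqr c ^+ d * T.
  rewrite -sum_freq_coef_sqr mulr_suml; apply: ler_sum => k _.
  by rewrite -mulr_sumr ler_wpM2l ?sqr_ge0.
under eq_bigr do rewrite -mulr_sumr big_split /= -!mulr_sumr.
rewrite -mulr_sumr big_split /= -!mulr_sumr.
rewrite mulrCA ler_wpM2l//.
have swap : \sum_(k : freq) \sum_(l | l != k) q l ^+ 2 * normc (coef A l k) =
    \sum_(k : freq) \sum_(l | l != k) q k ^+ 2 * normc (coef A k l).
  rewrite (exchange_big_dep xpredT)//=; apply: eq_bigr => k _.
  by apply: eq_bigl => l; rewrite eq_sym.
rewrite swap; under eq_bigr do rewrite mulr_sumr.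
by rewrite -mulrDl (_ : 1 / 2 + 1 / 2 = 1) ?mul1r//; field.
Qed.

End off_diagonal.

Section pair_counting.
Context {R : realType} {d n m p : nat}.
Local Notation M := m.+1.
Variables (c : 'I_n.+1 -> R) (delta eta B : R) (N : nat) (u : 'I_N -> 'rV[R]_d).
Hypotheses (d0 : (0 < d)%N) (np : (n.+1 <= 2 ^ p)%N) (pM : (2 ^ p.+1 %| M)%N).
Hypotheses (c0 : forall i, 0 <= c i) (c2 : 0 < coef_sqr c).
Hypotheses (delta0 : 0 <= delta) (Mdelta : M%:R^-1 <= delta) (eta0 : 0 <= eta).
Hypothesis tail1 : forall t, delta < distZ t -> line_kernel c t <= eta.
Hypotheses (B0 : 0 <= B)
  (expsum_le : forall k l : {ffun 'I_d -> 'I_n.+1}, l != k -> normc (expsum u k l) ^+ 2 <= B).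

(** The count lies between the smoothed counts of a slightly smaller and a slightly
    larger shell; their main terms differ from the volume by the densities of thin
    shells. *)
Lemma pair_count_bound (a b : R) :
  `|#|[pred ij : 'I_N * 'I_N | a <= tnorm (u ij.1 - u ij.2) <= b]|%:R
     - N%:R ^+ 2 * torus2_volume (@Omega R d a b)|
  <= B * Num.sqrt (12 * d%:R ^+ 4 * p.+1%:R ^+ 2 * n.+1%:R ^+ d.-1)
     + N%:R ^+ 2 * (d%:R * eta + 16 * d%:R ^+ 2 * (d%:R + 1) * delta).
Proof.
have nm : (n <= m)%N.
  rewrite -ltnS; apply: leq_trans np _; apply: leq_trans (dvdn_leq _ pM) => //.
  by rewrite leq_exp2l.
set T := Num.sqrt _; pose w := d%:R * delta.
have w0 : 0 <= w by rewrite mulr_ge0.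
have coefT (a' b' : R) (k : {ffun 'I_d -> 'I_n.+1}) :
    \sum_(l | l != k) normc (coef (@shell R d m a' b') k l) <= T :> R.
  apply: le_trans (ler_norm _) _; rewrite -sqrtr_sqr; apply: ler_wsqrtr.
  exact: (sum_coef_le d0 np pM a' b' k).
pose S (A : pred {ffun 'I_d -> 'I_m.+1}) := \sum_i \sum_j smooth c A (u i - u j).
have main (a' b' : R) : `|S (shell a' b') - N%:R ^+ 2 * density (@shell R d m a' b')| <= B * T.
  by have := sum_smooth_diag c0 c2 expsum_le (coefT a' b') B0; rewrite card_ord.
have cntE : #|[pred ij : 'I_N * 'I_N | a <= tnorm (u ij.1 - u ij.2) <= b]|%:R =
    \sum_i \sum_j (a <= tnorm (u i - u j) <= b)%R%:R :> R.
  by rewrite natr_card pair_bigA.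
have NN (x : R) : N%:R ^+ 2 * x = \sum_(i < N) \sum_(j < N) x.
  by rewrite !sumr_const !card_ord -mulrnA -[RHS]mulr_natl natrM expr2.
have up : #|[pred ij : 'I_N * 'I_N | a <= tnorm (u ij.1 - u ij.2) <= b]|%:R <=
    S (shell (a - w) (b + w)) + N%:R ^+ 2 * (d%:R * eta).
  rewrite cntE NN /S -big_split /=; apply: ler_sum => i _; rewrite -big_split /=.
  by apply: ler_sum => j _; exact: smooth_majorant.
have lo : S (shell (a + w) (b - w)) <=
    #|[pred ij : 'I_N * 'I_N | a <= tnorm (u ij.1 - u ij.2) <= b]|%:R +
    N%:R ^+ 2 * (d%:R * eta).
  rewrite cntE NN /S -big_split /=; apply: ler_sum => i _; rewrite -big_split /=.
  by apply: ler_sum => j _; exact: smooth_minorant.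
have := main (a - w) (b + w); rewrite ler_norml => /andP[_ mainup].
have := main (a + w) (b - w); rewrite ler_norml => /andP[mainlo _].
have wup := density_shell_widen m a b d0 w0.
have := density_shell_widen m (a + w) (b - w) d0 w0; rewrite addrK subrK => wlo.
have := torus2_volume_density m a b d0; rewrite ler_norml => /andP[vlo vup].
have N0 : 0 <= N%:R ^+ 2 :> R by rewrite exprn_ge0.
set V := torus2_volume _ in vlo vup *.
set D := density (shell a b) in wup wlo vlo vup.
set D1 := density _ in mainup wup; set D2 := density _ in mainlo wlo.
set Cnt := #|_|%:R in up lo *.
set S1 := S _ in up mainup; set S2 := S _ in lo mainlo.
set BT := B * T in mainup mainlo *.
have e1 : 8 * d%:R ^+ 2 * (w + M%:R^-1) <= 8 * d%:R ^+ 2 * (d%:R + 1) * delta.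
  rewrite -[leRHS]mulrA ler_wpM2l ?mulr_ge0 ?exprn_ge0// mulrDl mul1r.
  by rewrite lerD2l.
have e2 : 8 * d%:R ^+ 2 * (d%:R + 1) / M%:R <= 8 * d%:R ^+ 2 * (d%:R + 1) * delta.
  by rewrite ler_wpM2l// ?mulr_ge0 ?exprn_ge0 ?addr_ge0.
set e := 8 * d%:R ^+ 2 * (d%:R + 1) * delta in e1 e2.
have -> : 16 * d%:R ^+ 2 * (d%:R + 1) * delta = 2 * e by rewrite /e; ring.
set f := 8 * _ * _ in e1 wup wlo; set g := 8 * _ * _ / _ in e2 vlo vup.
clearbody V D D1 D2 Cnt S1 S2 BT e f g.
have d1 : N%:R ^+ 2 * (D1 - V) <= N%:R ^+ 2 * (2 * e) by rewrite ler_wpM2l//; lra.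
have d2 : N%:R ^+ 2 * (V - D2) <= N%:R ^+ 2 * (2 * e) by rewrite ler_wpM2l//; lra.
rewrite !mulrDr; rewrite !mulrBr in d1 d2.
by rewrite ler_norml; apply/andP; split; lra.
Qed.

End pair_counting.

(** * A concrete kernel and the exponential sums of the sequence *)

Section jackson.
Context {R : realType}.
Variables (r L : nat).
Hypotheses (r0 : (0 < r)%N) (L0 : (0 < L)%N).
Local Notation n := (r * L).-1.

Let poly_sum : {poly R} := \sum_(i < L) 'X^i.
Let jackson_poly : {poly R} := poly_sum ^+ r.

Let nE : n.+1 = (r * L)%N.
Proof. by rewrite prednK// muln_gt0 r0. Qed.

Let size_jackson : (size jackson_poly <= n.+1)%N.
Proof.
have sz : (size poly_sum <= L)%N.
  apply: leq_trans (size_sum _ _ _) _; apply/bigmax_leqP => i _.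
  by rewrite size_polyXn.
apply: leq_trans (size_poly_exp_leq _ _) _; rewrite nE.
apply: leq_ltn_trans (leq_mul (_ : (size poly_sum).-1 <= L.-1)%N (leqnn r)) _; first by lia.
by rewrite -(prednK L0) /= mulnS mulnC -[X in (X < _)%N]add0n ltn_add2r.
Qed.

(** The coefficients of the r-th power of the Dirichlet kernel of length L. The
    resulting [line_kernel] lives at scale 1 / L and decays like the power - 2 r of
    the distance; beyond distance L^(-1 + eps) it is thus smaller than any given
    power of 1 / L once r is large. *)
Definition jackson (i : 'I_n.+1) : R := jackson_poly`_i.

Lemma jackson_ge0 i : 0 <= jackson i.
Proof.
rewrite /jackson /jackson_poly; elim: r (nat_of_ord i) => [|k IH] j.
  by rewrite expr0 coef1 ler0n.
rewrite exprS coefM; apply: sumr_ge0 => a _; apply: mulr_ge0 => //.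
by rewrite coef_sum; apply: sumr_ge0 => b _; rewrite coefXn ler0n.
Qed.

Lemma sum_jackson : \sum_i jackson i = L%:R ^+ r.
Proof.
have := horner_coef_wide (1 : R) size_jackson.
under eq_bigr do rewrite expr1n mulr1.
move=> <-; rewrite /jackson_poly horner_exp /poly_sum horner_sum.
by under eq_bigr do rewrite hornerXn expr1n; rewrite sumr_const card_ord.
Qed.

Lemma trigpoly_jackson t : trigpoly jackson t = (\sum_(i < L) expi2pi t ^+ i) ^+ r.
Proof.
pose f : {rmorphism R -> R[i]} := real_complex R.
have sz : (size (map_poly f jackson_poly) <= n.+1)%N by rewrite size_map_poly.
have := horner_coef_wide (expi2pi t) sz.
under eq_bigr do rewrite coef_map /=.
rewrite /trigpoly => <-; rewrite rmorphXn horner_exp; congr (_ ^+ r).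
rewrite rmorph_sum horner_sum; apply: eq_bigr => i _.
by rewrite /= map_polyXn hornerXn.
Qed.

(** Cauchy-Schwarz: r L coefficients with sum L^r. *)
Lemma coef_sqr_jackson : L%:R ^+ (2 * r) <= (r * L)%:R * coef_sqr jackson.
Proof.
have := cauchy_schwarz jackson (fun=> 1).
under eq_bigr do rewrite mulr1.
rewrite sum_jackson -exprM mulnC; under [X in _ * X]eq_bigr do rewrite expr1n.
have nR : n.+1%:R = (r * L)%:R :> R by rewrite nE.
by rewrite sumr_const card_ord nR mulrC.
Qed.

Lemma coef_sqr_jackson_gt0 : 0 < coef_sqr jackson.
Proof.
have rL0 : 0 < (r * L)%:R :> R by rewrite ltr0n muln_gt0 r0.
rewrite -(pmulr_rgt0 _ rL0); apply: lt_le_trans coef_sqr_jackson.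
by rewrite exprn_gt0 ?ltr0n.
Qed.

Lemma line_kernel_jackson (delta t : R) : 0 < delta -> delta < distZ t ->
  line_kernel jackson t <= (r * L)%:R / (L%:R * delta) ^+ (2 * r).
Proof.
move=> del0 delt; have t0 : 0 < distZ t by apply: lt_trans delt.
rewrite /line_kernel trigpoly_jackson normcX -exprM [(r * 2)%N]mulnC.
have L0' : 0 < L%:R :> R by rewrite ltr0n.
have rL0 : 0 < (r * L)%:R :> R by rewrite ltr0n muln_gt0 r0.
rewrite exprMn invfM mulrA ler_pdivrMr ?coef_sqr_jackson_gt0//.
set s := normc _.
have s0 : 0 <= s by exact: normc_ge0.
have sd : s <= delta^-1.
  rewrite -[leRHS]mul1r ler_pdivlMr//.
  apply: le_trans (normc_geometric_le t L); rewrite -/s mulrC.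
  by rewrite ler_wpM2r// ltW.
apply: (@le_trans _ _ (delta^-1 ^+ (2 * r))).
  by rewrite lerXn2r ?nnegrE ?invr_ge0// ltW.
rewrite exprVn mulrAC ler_peMl ?invr_ge0 ?exprn_ge0 ?(ltW del0)//.
by rewrite mulrAC ler_pdivlMr ?exprn_gt0// mul1r coef_sqr_jackson.
Qed.

End jackson.

Section exponential_sums.
Context {R : realType} {d : nat}.

Lemma enorm_lattice_le (k : 'rV[int]_d) D : (forall i, `|k 0 i| <= D%:Z) ->
  enorm (lattice_pt k : 'rV[R]_d) <= d%:R * D%:R.
Proof.
move=> kD; rewrite /enorm (eq_bigr (fun i => `|(k 0 i)%:~R| ^+ 2)) => [|i _]; last first.
  by rewrite real_normK ?num_real// mxE.
apply: le_trans (sqrt_sum_sqr_le _) _ => [i|]; first exact: normr_ge0.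
apply: (@le_trans _ _ (\sum_(i < d) D%:R)); last by rewrite sumr_const card_ord mulr_natl.
by apply: ler_sum => i _; rewrite -intr_norm -[D%:R]/(D%:Z%:~R) ler_int.
Qed.

Lemma char_quotient n (k l : {ffun 'I_d -> 'I_n.+1}) (z : 'rV[R]_d) :
  char k z * conjc (char l z) =
  expi2pi (dot (lattice_pt (\row_i ((k i)%:Z - (l i)%:Z))) z).
Proof.
rewrite /dot expi2pi_sum -charN /char -big_split /=; apply: eq_bigr => i _.
rewrite !mxE -!expi2pi_mulrn -expi2piD; congr expi2pi.
by rewrite intrB mulrBl -!pmulrn mulNrn !mulr_natl.
Qed.

Lemma expsum_le_uniform (v : nat -> 'rV[R]_d) (gamma eps C : R) (n N : nat)
    (k l : {ffun 'I_d -> 'I_n.+1}) : 0 <= eps -> (1 <= N)%N ->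
  (forall (k : 'rV[int]_d) N, k != 0 -> (1 <= N)%N ->
    `| N%:R^-1 * \sum_(1 <= n < N.+1) expi2pi (dot (lattice_pt k) (v n)) |
      <= (C * enorm (lattice_pt k) `^ eps * N%:R `^ (- gamma))%:C%C) ->
  l != k ->
  normc (expsum (fun i : 'I_N => v i.+1) k l) <=
    N%:R * (`|C| * (d%:R * n.+1%:R) `^ eps * N%:R `^ (- gamma)).
Proof.
move=> eps0 N1 vC lk; have N0 : 0 < N%:R :> R by rewrite ltr0n.
pose kap : 'rV[int]_d := \row_i ((k i)%:Z - (l i)%:Z).
have kap0 : kap != 0.
  apply: contraNneq lk => /rowP kap0; apply/eqP/ffunP => i; apply/val_inj.
  by have /eqP := kap0 i; rewrite !mxE subr_eq0 eqz_nat => /eqP/esym.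
have sumE : expsum (fun i : 'I_N => v i.+1) k l =
    \sum_(1 <= n < N.+1) expi2pi (dot (lattice_pt kap) (v n)).
  by rewrite big_add1 /= big_mkord; apply: eq_bigr => i _; exact: char_quotient.
have := vC kap N kap0 N1; rewrite -sumE.
set S := expsum _ _ _.
have -> : `|N%:R^-1 * S| = (N%:R^-1 * normc S)%:C%C.
  rewrite normrM rmorphM; congr (_ * _).
  by rewrite ger0_norm ?invr_ge0 ?ler0n// fmorphV rmorph_nat.
rewrite lecR mulrC ler_pdivrMr// mulrC => SC; apply: le_trans SC _.
rewrite ler_pM2l//; apply: ler_wpM2r; first exact: powR_ge0.
apply: le_trans (ler_wpM2r (powR_ge0 _ _) (ler_norm C)) _; apply: ler_wpM2l => //.
apply: ge0_ler_powR; rewrite ?nnegrE ?sqrtr_ge0 ?mulr_ge0//.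
apply: enorm_lattice_le => i; rewrite mxE.
by have := ltn_ord (k i); have := ltn_ord (l i); lia.
Qed.

End exponential_sums.

(** * Choosing the parameters *)

Section asymptotics.
Context {R : realType} {d : nat}.

(** The logarithm of the number of frequencies is absorbed in an arbitrarily small
    power. *)
Lemma log_le_powR (s D : R) p : 0 < s -> (2 ^ p)%:R <= 2 * D ->
  p.+1%:R <= (s * ln 2)^-1 * (4 * D) `^ s.
Proof.
move=> s0 pD; have l2 : 0 < ln 2 :> R by rewrite ln_gt0 ?ltr1n.
have sl : 0 < s * ln 2 by exact: mulr_gt0.
rewrite mulrC ler_pdivlMr//.
have P0 : 0 < 2 ^+ p.+1 :> R by rewrite exprn_gt0.
have PD : 2 ^+ p.+1 <= 4 * D by rewrite exprS; move: pD; rewrite natrX; lra.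
have D0 : 0 <= 4 * D by apply: le_trans PD; exact: ltW.
apply: (@le_trans _ _ ((2 ^+ p.+1) `^ s)); last first.
  by apply: ge0_ler_powR; rewrite ?nnegrE// ltW.
rewrite /powR gt_eqF// lnXn//.
apply: le_trans (expR_ge1Dx _).
by rewrite -[ln 2 *+ _]mulr_natl mulrCA; lra.
Qed.

Variables (gamma eps : R) (v : nat -> 'rV[R]_d).
Hypotheses (d0 : (0 < d)%N) (gamma0 : 0 < gamma <= 1 / 2) (eps0 : 0 < eps)
  (v_ud : uniformly_distributed gamma v).
Local Notation theta := (4 * gamma / d.+1%:R).

Let theta01 : 0 < theta <= 1.
Proof.
have d2 : 2 <= d.+1%:R :> R by rewrite ler_nat ltnS.
case/andP: gamma0 => g0 g1; rewrite divr_gt0 ?mulr_gt0 ?ltr0n//=.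
by rewrite ler_pdivrMr ?ltr0n//; lra.
Qed.

(** With x = N and theta = 4 gamma / (d + 1), the kernel has degree about x^theta
    and width delta = x^(-theta + eps). The boundary error is x^2 delta; the
    off-diagonal error is x^(2 - 2 gamma) times the sum of the Fourier coefficients,
    about x^(theta (d - 1) / 2), and theta is chosen to make the two agree. *)
Lemma remainder_bound : exists C : R, 0 < C /\
  forall (N : nat) (a b : R), (1 <= N)%N ->
    `|remainder v a b N| <= C * N%:R `^ (2 - theta + eps).
Proof.
(* The loss x^s occurs three times: twice from the squared exponential sums, once
   from the logarithm. *)
pose s := eps / 3; have s0 : 0 < s by rewrite divr_gt0.
have [C vC] := v_ud s0.
(* Large enough for the tail (L delta)^(- 2 r) to be at most x^-2. *)
pose r := (Num.truncn eps^-1).+1.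
have r1 : 1 <= r%:R * eps.
  by rewrite -ler_pdivrMr// div1r ltW// truncnS_gt.
have r2 : 2%:R <= eps * (2%:R * r%:R) by move: r1; lra.
have r0 : 0 < r%:R :> R by rewrite ltr0n.
have d0R : 0 < d%:R :> R by rewrite ltr0n.
pose K1 := `|C| ^+ 2 * (2 * d%:R * r%:R) `^ s ^+ 2 *
  (4 * d%:R ^+ 2 * ((s * ln 2)^-1 * (8 * r%:R) `^ s) * Num.sqrt ((2 * r%:R) ^+ d.-1)) : R.
pose K2 := 2 * d%:R * r%:R + 16 * d%:R ^+ 2 * (d%:R + 1) : R.
have K1_0 : 0 <= K1.
  rewrite /K1; repeat first [apply: mulr_ge0 | apply: powR_ge0 | apply: sqrtr_ge0
     | apply: exprn_ge0 | rewrite invr_ge0 | exact: normr_ge0] => //.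
    exact: ltW.
  by rewrite ln_ge0// ler1n.
have K2_0 : 0 < K2.
  by rewrite addr_gt0// !mulr_gt0// ?exprn_gt0// addr_gt0.
exists (K1 + K2); split; first by rewrite ltr_wpDl.
move=> N a b N1; pose x : R := N%:R.
have x1 : 1 <= x by rewrite ler1n.
have x0 : 0 < x by apply: lt_le_trans x1.
have xn0 : x != 0 by rewrite gt_eqF.
have xD p q : x `^ (p + q) = x `^ p * x `^ q by rewrite powRD// xn0 implybT.
case/andP: theta01 => th0 th1.
pose X := x `^ theta; have X1 : 1 <= X by rewrite -(powRr0 x) ler_powR// ltW.
have X0 : 0 < X by apply: lt_le_trans X1.
have Xx : X <= x by rewrite -[leRHS]powRr1 ?(ltW x0)// ler_powR.
pose L := (Num.truncn X).+1.
have XL : X <= L%:R by rewrite ltW// truncnS_gt.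
have L2X : L%:R <= 2 * X.
  have LX : (Num.truncn X)%:R <= X by rewrite truncn_le ltW.
  by rewrite /L -[(Num.truncn X).+1%:R]natr1; lra.
pose D := (r * L)%N.
have DE : (r * L).-1.+1 = D by rewrite prednK// muln_gt0.
have DX : D%:R <= 2 * r%:R * X by rewrite natrM; nra.
have D0 : (0 < D)%N by rewrite muln_gt0.
pose p := (trunc_log 2 D).+1.
have /andP[pD1 pD2] := trunc_log_bounds (isT : (1 < 2)%N) D0.
have pD : (2 ^ p)%:R <= 2 * D%:R :> R by rewrite expnS natrM ler_pM2l// ler_nat.
pose delta := x `^ (- theta + eps).
have delta0 : 0 < delta by exact: powR_gt0.
(* The grid size is a power of two, divisible by all dyadic scales in use, and the
   mesh is finer than delta. *)
pose q := (p.+1 + (Num.truncn delta^-1).+1)%N.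
pose m := (2 ^ q).-1.
have mE : m.+1 = (2 ^ q)%N by rewrite prednK// expn_gt0.
have pM : (2 ^ p.+1 %| m.+1)%N by rewrite mE dvdn_exp2l// leq_addr.
have Mdelta : m.+1%:R^-1 <= delta.
  rewrite -[leRHS]invrK lef_pV2 ?posrE ?invr_gt0 ?ltr0n//.
  apply: le_trans (ltW (truncnS_gt _)) _; rewrite ler_nat mE.
  by apply: leq_trans (leq_addl p.+1 _) _; exact/ltnW/ltn_expl.
pose eta := (r * L)%:R / (L%:R * delta) ^+ (2 * r).
have L0 : 0 < L%:R :> R by rewrite ltr0n.
have eta0 : 0 <= eta by rewrite divr_ge0// exprn_ge0// mulr_ge0// ltW.
pose E := N%:R * (`|C| * (d%:R * D%:R) `^ s * N%:R `^ (- gamma)).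
have E0 : 0 <= E by rewrite !mulr_ge0 ?powR_ge0.
have np : ((r * L).-1.+1 <= 2 ^ p)%N by rewrite DE ltnW.
have expsum_le (k l : {ffun 'I_d -> 'I_((r * L).-1.+1)}) : l != k ->
    normc (expsum (fun i : 'I_N => v i.+1) k l) ^+ 2 <= E ^+ 2.
  move=> lk; rewrite lerXn2r ?nnegrE//; first exact: normc_ge0.
  have := expsum_le_uniform (ltW s0) N1 vC lk.
  by rewrite (_ : (r * L).-1.+1%:R = D%:R) // DE.
have tail t := @line_kernel_jackson R r L isT isT delta t delta0.
have := pair_count_bound d0 np pM (@jackson_ge0 R r L)
  (coef_sqr_jackson_gt0 (isT : (0 < r)%N) (isT : (0 < L)%N))
  (ltW delta0) Mdelta eta0 tail (exprn_ge0 2 E0) expsum_le a b.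
rewrite -[X in `|X|]/(remainder v a b N) => bound; apply: le_trans bound _.
rewrite (_ : (r * L).-1.+1%:R = D%:R :> R); last by rewrite DE.
rewrite -/x [leRHS]mulrDl; apply: lerD; last first.
  have -> : x `^ (2 - theta + eps) = x ^+ 2 * delta.
    by rewrite -addrA xD powR_mulrn// ltW.
  have deltaX : delta * X = x `^ eps by rewrite -xD addrAC addNr add0r.
  have xeps1 : 1 <= x `^ eps by rewrite -(powRr0 x) ler_powR// ltW.
  have P1 : X * X <= (L%:R * delta) ^+ (2 * r).
    apply: (@le_trans _ _ (x `^ eps ^+ (2 * r))).
      rewrite -powR_mulrn ?powR_ge0// -powRrM.
      apply: (@le_trans _ _ (x `^ 2%:R)).
        by rewrite (powR_mulrn _ (ltW x0)) expr2; apply: ler_pM => //; exact: ltW.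
      by apply: ler_powR => //; rewrite natrM.
    rewrite lerXn2r ?nnegrE ?powR_ge0 ?mulr_ge0 ?(ltW delta0)// -deltaX mulrC.
    by rewrite ler_wpM2r// ltW.
  have etaB : eta <= 2 * r%:R * delta.
    rewrite /eta ler_pdivrMr ?exprn_gt0 ?mulr_gt0//.
    apply: (@le_trans _ _ (2 * r%:R * delta * (X * X))); last first.
      by rewrite ler_wpM2l// !mulr_ge0// ltW.
    rewrite natrM; apply: (@le_trans _ _ (r%:R * (2 * X))).
      by rewrite ler_wpM2l// ltW.
    have rX : r%:R * X * 1 <= r%:R * X * (delta * X).
      by rewrite ler_wpM2l ?deltaX// mulr_ge0// ltW.
    by clear -rX; clearbody X delta; lra.
  have dB : d%:R * eta <= d%:R * (2 * r%:R * delta) by rewrite ler_wpM2l.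
  have -> : K2 * (x ^+ 2 * delta) = x ^+ 2 * (K2 * delta) by ring.
  rewrite ler_wpM2l ?sqr_ge0// /K2.
  by clear -dB; clearbody delta eta; lra.
pose t := theta * (d.-1%:R / 2).
have sqX : Num.sqrt (X ^+ d.-1) = x `^ t.
  rewrite -[LHS]powR12_sqrt ?exprn_ge0 ?(ltW X0)// -powR_mulrn ?(ltW X0)//.
  by rewrite /X -!powRrM.
have E_le : E <= x * (`|C| * ((2 * d%:R * r%:R) `^ s * x `^ s) * x `^ (- gamma)).
  rewrite /E -/x ler_pM2l// ler_wpM2r ?powR_ge0// ler_wpM2l//.
  rewrite -powRM ?mulr_ge0 ?(ltW x0)//; apply: ge0_ler_powR;
    rewrite ?nnegrE ?(ltW s0)// ?mulr_ge0 ?(ltW x0)//.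
  have h1 : d%:R * D%:R <= d%:R * (2 * r%:R * X) by rewrite ler_wpM2l.
  have h2 : 2 * d%:R * r%:R * X <= 2 * d%:R * r%:R * x by rewrite ler_wpM2l// !mulr_ge0.
  by clear -h1 h2; clearbody X D x r; lra.
have sl0 : 0 <= (s * ln 2)^-1.
  by rewrite invr_ge0; apply: mulr_ge0; [exact: ltW | rewrite ln_ge0// ler1n].
have p_le : p.+1%:R <= (s * ln 2)^-1 * ((8 * r%:R) `^ s * x `^ s).
  apply: le_trans (log_le_powR s0 pD) _.
  rewrite ler_wpM2l// -powRM ?mulr_ge0 ?(ltW x0)//; apply: ge0_ler_powR;
    rewrite ?nnegrE ?(ltW s0)// ?mulr_ge0 ?(ltW x0)//.
  have h1 : r%:R * X <= r%:R * x by rewrite ler_wpM2l.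
  by clear -h1 DX; clearbody X D x r; lra.
have T_le : Num.sqrt (12 * d%:R ^+ 4 * p.+1%:R ^+ 2 * D%:R ^+ d.-1) <=
    4 * d%:R ^+ 2 * ((s * ln 2)^-1 * ((8 * r%:R) `^ s * x `^ s)) *
    (Num.sqrt ((2 * r%:R) ^+ d.-1) * x `^ t).
  apply: (@le_trans _ _ (Num.sqrt ((4 * d%:R ^+ 2 * p.+1%:R) ^+ 2 * D%:R ^+ d.-1))).
    apply: ler_wsqrtr; apply: ler_wpM2r; first exact: exprn_ge0.
    have -> : (4 * d%:R ^+ 2 * p.+1%:R) ^+ 2 = 16 * (d%:R ^+ 4 * p.+1%:R ^+ 2) :> R.
      by move: (p.+1%:R : R) => P; ring.
    by rewrite -mulrA ler_wpM2r ?mulr_ge0 ?exprn_ge0// ler_nat.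
  rewrite sqrtrM ?sqr_ge0// sqrtr_sqr ger0_norm ?mulr_ge0 ?exprn_ge0//.
  apply: ler_pM; rewrite ?mulr_ge0 ?exprn_ge0 ?sqrtr_ge0//.
    by rewrite ler_wpM2l// mulr_ge0 ?exprn_ge0.
  rewrite -sqX -sqrtrM ?exprn_ge0 ?mulr_ge0// -exprMn; apply: ler_wsqrtr.
  by rewrite lerXn2r ?nnegrE ?mulr_ge0// ltW.
apply: (@le_trans _ _ ((x * (`|C| * ((2 * d%:R * r%:R) `^ s * x `^ s) * x `^ (- gamma))) ^+ 2 *
  (4 * d%:R ^+ 2 * ((s * ln 2)^-1 * ((8 * r%:R) `^ s * x `^ s)) *
    (Num.sqrt ((2 * r%:R) ^+ d.-1) * x `^ t)))).
  apply: ler_pM; rewrite ?exprn_ge0 ?sqrtr_ge0//.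
  by rewrite lerXn2r ?nnegrE// (le_trans E0 E_le).
have -> : x `^ (2 - theta + eps) = x ^+ 2 * x `^ s ^+ 3 * x `^ (- gamma) ^+ 2 * x `^ t.
  rewrite -[x `^ s ^+ 3]powR_mulrn ?powR_ge0// -[x `^ (- gamma) ^+ 2]powR_mulrn ?powR_ge0//.
  rewrite -powR_mulrn ?(ltW x0)// -!powRrM -!xD; congr (x `^ _).
  rewrite /t /s.
  have e0 : d.-1%:R + 2 != 0 :> R by rewrite gt_eqF// ltr_wpDl.
  have -> : d.+1%:R = d.-1%:R + 2 :> R by rewrite -natrD addn2 prednK.
  by move: (d.-1%:R : R) e0 => y y0; field.
rewrite le_eqVlt; apply/orP; left; apply/eqP; rewrite /K1.
move: (x `^ s) (x `^ (- gamma)) (x `^ t) (Num.sqrt _) ((8 * r%:R) `^ s).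
move: ((s * ln 2)^-1) ((2 * d%:R * r%:R) `^ s) => *.
by ring.
Qed.

End asymptotics.

Theorem theorem1p2 (R : realType) (d : nat) (gamma : R) (v : nat -> 'rV[R]_d)
    (d_ge2 : (2 <= d)%N)
    (gamma_range : 0 < gamma <= 1 / 2)
    (v_ud : uniformly_distributed gamma v) :
  (forall eps : R, 0 < eps ->
     exists C : R, 0 < C /\
       forall (N : nat) (a b : R),
         (1 <= N)%N -> 1 / 100 <= a -> a <= b -> b < 1 / 2 ->
         `| remainder v a b N |
           <= C * N%:R `^ (2 - 4 * gamma / d.+1%:R + eps)) /\
  (forall c eps : R, 0 < c -> 0 < eps ->
     exists (A1 A2 : R) (N0 : nat), 0 < A1 /\ A1 <= A2 /\
       forall (N : nat) (a b : R),
         (N0 <= N)%N -> 1 / 100 <= a -> a <= b -> b < 1 / 2 ->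
         c * N%:R `^ (- (4 * gamma / d.+1%:R) + eps) <= b - a ->
         A1 * N%:R ^+ 2 * (b - a) <= (incidences v a b N)%:R
           <= A2 * N%:R ^+ 2 * (b - a)).
Proof.
have d0 : (0 < d)%N by exact: leq_trans d_ge2.
have d0R : 0 < d%:R :> R by rewrite ltr0n.
split=> [eps eps0|c eps c0 eps0].
  have [C [C0 bound]] := remainder_bound d0 gamma_range eps0 v_ud.
  by exists C; split=> // N a b N1 _ _ _; exact: bound.
have eps2 : 0 < eps / 2 by exact: divr_gt0.
have [C [C0 bound]] := remainder_bound d0 gamma_range eps2 v_ud.
set theta := 4 * gamma / d.+1%:R in bound *.
pose c1 : R := (200 * d%:R)^-1 ^+ d.
have c1_gt0 : 0 < c1 by rewrite exprn_gt0// invr_gt0 mulr_gt0.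
pose K : R := 4 * d%:R ^+ 2.
have K0 : 0 <= K by rewrite mulr_ge0// exprn_ge0.
(* Once x^(eps / 2) >= Z, the remainder is at most half of the lower bound
   c1 x^2 (b - a) for the main term. *)
pose Z := 2 * C / (c * c1).
have cc1 : 0 < c * c1 by exact: mulr_gt0.
have Z0 : 0 <= Z by rewrite divr_ge0// ?mulr_ge0// ltW.
exists (c1 / 2), (K + c1 / 2), (Num.truncn (Z `^ (2 / eps))).+1.
split; first by rewrite divr_gt0.
split; first by rewrite lerDr.
move=> N a b NN0 a0 ab b2 gap.
have N1 : (1 <= N)%N by exact: leq_ltn_trans NN0.
pose x : R := N%:R.
have x0 : 0 < x by rewrite ltr0n.
have xn0 : x != 0 by rewrite gt_eqF.
have xD p q : x `^ (p + q) = x `^ p * x `^ q by rewrite powRD// xn0 implybT.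
have Zx : Z <= x `^ (eps / 2).
  have -> : Z = (Z `^ (2 / eps)) `^ (eps / 2).
    rewrite -powRrM (_ : 2 / eps * (eps / 2) = 1) ?powRr1//.
    by field; rewrite gt_eqF.
  apply: ge0_ler_powR; rewrite ?nnegrE ?powR_ge0 ?(ltW x0) ?(ltW eps2)//.
  by apply: le_trans (ltW (truncnS_gt _)) _; rewrite ler_nat.
have WE : x `^ (2 - theta + eps / 2) * x `^ (eps / 2) = x ^+ 2 * x `^ (- theta + eps).
  rewrite -(powR_mulrn 2 (ltW x0)) -!xD; congr (x `^ _).
  by field.
have small : `|remainder v a b N| <= c1 / 2 * (x ^+ 2 * (b - a)).
  apply: le_trans (bound N a b N1) _; rewrite -/x.
  have h1 : x ^+ 2 * (c * x `^ (- theta + eps)) <= x ^+ 2 * (b - a).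
    by apply: ler_wpM2l; [exact: sqr_ge0 | exact: gap].
  have h2 : 2 * C <= x `^ (eps / 2) * (c * c1) by rewrite -ler_pdivrMr.
  have W0 := powR_ge0 x (2 - theta + eps / 2).
  apply: (@le_trans _ _ (c1 / 2 * (x ^+ 2 * (c * x `^ (- theta + eps))))); last first.
    by apply: ler_wpM2l => //; rewrite divr_ge0// ltW.
  have -> : x ^+ 2 * (c * x `^ (- theta + eps)) =
      c * (x `^ (2 - theta + eps / 2) * x `^ (eps / 2)) by rewrite WE mulrCA.
  have := ler_wpM2l W0 h2; clear.
  by move: (x `^ _) (x `^ _) => W y; lra.
have Vlo := torus2_volume_ge d0 a0 ab b2; have Vup := torus2_volume_le (R := R) d0 ab.
have N2 : 0 <= x ^+ 2 by exact: sqr_ge0.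
have {}Vlo := ler_wpM2l N2 Vlo; have {}Vup := ler_wpM2l N2 Vup.
move: small; rewrite incidencesE /remainder -/x ler_norml => /andP[].
move: Vlo Vup; rewrite -/c1 -/K.
move: (torus2_volume _) (pair_count v a b N)%:R => V P; clear.
by move: (x ^+ 2) => y *; apply/andP; split; lra.
Qed.
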